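(* Let $(X,\rho,\mu)$ be a doubling metric measure space. For $p,s\in(0,\infty)$, let $$\dot B^s_{p,p}(\mu):=\Big\{f\in L^p_{\mathrm{loc}}(\mu):\iint_{X\times X}\Big(\frac{|f(x)-f(y)|}{\rho(x,y)^s}\Big)^p\frac{d\mu(x)\,d\mu(y)}{V(x,y)}<\infty\Big\},$$ $$\dot B^p(\mu):=\Big\{f\in L^p_{\mathrm{loc}}(\mu):\iint_{X\times X}|f(x)-f(y)|^p\frac{d\mu(x)\,d\mu(y)}{V(x,y)^2}<\infty\Big\}.$$ Let $d\in[1,\infty)$, and suppose that $(X,\rho,\mu)$ satisfies a $(1,d)$-Poincaré inequality. (1) Then $\dot B^1_{d,d}(\mu)=\{\text{constants}\}$. (2) If, in addition, $(X,\rho,\mu)$ has lower dimension $d$, then $\dot B^p(\mu)=\{\text{constants}\}$ for all $p\in(0,d]$.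
   Context: A metric measure space $(X,\rho,\mu)$ is doubling if there is a constant $c_\mu$ with $\mu(B(x,2r))\le c_\mu\,\mu(B(x,r))$ for all $x\in X$, $r>0$, where $B(x,r)=\{y:\rho(x,y)<r\}$; as usual, all balls have positive and finite measure. Completeness of $X$ is not assumed. $V(x,r):=\mu(B(x,r))$ and $V(x,y):=\mu(B(x,\rho(x,y)))$; the integrands above are understood to vanish when $x=y$. $L^p_{\mathrm{loc}}(\mu)$ is the class of measurable $f$ with $1_Bf\in L^p(\mu)$ for every ball $B$. $\langle f\rangle_B:=\frac1{\mu(B)}\int_Bf\,d\mu$. Functions are identified when equal $\mu$-a.e., so ''constants'' means functions equal to a constant $\mu$-almost everywhere. Lower dimension $d$: $\big(\frac Rr\big)^d\le C\,\frac{V(x,R)}{V(x,r)}$ for some constant $C$ and all $x\in X$ and $0<r\le R<2\operatorname{diam}(X)$. Pointwise Lipschitz constant: $\operatorname{lip}f(x):=\liminf_{t\to0}\sup_{\rho(x,y)\le t}\frac{|f(x)-f(y)|}{t}$. $(1,q)$-Poincaré inequality, $q\in[1,\infty)$: there are constants $\lambda\in[1,\infty)$ and $c_P\in(0,\infty)$ such that $$\frac{1}{\mu(B(z,r))}\int_{B(z,r)}|f-\langle f\rangle_{B(z,r)}|\,d\mu\le c_P\, r\Big(\frac{1}{\mu(B(z,\lambda r))}\int_{B(z,\lambda r)}(\operatorname{lip}f)^q\,d\mu\Big)^{1/q}$$ for all $z\in X$, $r>0$ and all Lipschitz functions $f$ on $X$. *)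

(* Defs.v *)
From HB Require Import structures.
From mathcomp Require Import all_boot all_order all_algebra.
From mathcomp Require Import all_classical all_reals all_analysis.
Set Implicit Arguments.
Unset Strict Implicit.
Unset Printing Implicit Defensive.
Import Order.TTheory GRing.Theory Num.Theory.
Import numFieldNormedType.Exports.
Local Open Scope classical_set_scope.
Local Open Scope ring_scope.

HB.mixin Record isBorelMetric (R : realType) (disp : measure_display) T
    & Metric R T & Measurable disp T := {
  measurable_borel : @measurable disp T = <<s @open T >>
}.

#[short(type="borelMetricType")]
HB.structure Definition BorelMetric (R : realType) (disp : measure_display) :=
  {T of isBorelMetric R disp T & Metric R T & Measurable disp T}.

Section metric_measure_space.
Context {R : realType} {disp : measure_display} {X : borelMetricType R disp}.
Variable mu : {measure set X -> \bar R}.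
Implicit Types (f : X -> R) (x y z : X) (p q r s d : R).

(* [ball x r] is [set y | mdist x y < r] by [ballEmdist]; in particular it is
   empty for r <= 0. *)
Definition doubling : Prop :=
  (forall x r, 0 < r -> (0 < mu (ball x r) < +oo)%E) /\
  (exists c : R, forall x r, 0 < r ->
    (mu (ball x (2 * r)) <= c%:E * mu (ball x r))%E).

(* [fine] is harmless here: balls have finite measure under [doubling]. *)
Definition vol x r : R := fine (mu (ball x r)).

Definition diameter : \bar R :=
  ereal_sup [set (mdist u.1 u.2)%:E | u in [set: X * X]].

Definition lower_dimension d : Prop :=
  exists C : R, forall x (r r' : R), 0 < r -> r <= r' ->
    (r'%:E < 2%:E * diameter)%E ->
    (r' / r) `^ d <= C * (vol x r' / vol x r).

(* The limit inferior as t -> 0 is over t > 0. *)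
Definition lip f x : \bar R :=
  limf_einf
    (fun t : R => ereal_sup
      [set (`|f x - f y| / t)%:E | y in [set y | mdist x y <= t]])
    (0 : R)^'+.

(* The library's [lipschitz] needs a normed module as domain. *)
Definition lipschitz_fun f : Prop :=
  exists L : R, forall x y, `|f x - f y| <= L * mdist x y.

Definition mean f z r : R := (vol z r)^-1 * \int[mu]_(x in ball z r) f x.

Definition poincare q : Prop :=
  exists lambda cP : R, [/\ 1 <= lambda, 0 < cP &
    forall z r f, 0 < r -> lipschitz_fun f ->
      (((vol z r)^-1)%:E
         * \int[mu]_(x in ball z r) (`|f x - mean f z r|)%:E
       <= (cP * r)%:E
         * (((vol z (lambda * r))^-1)%:E
             * \int[mu]_(x in ball z (lambda * r)) (lip f x `^ q)) `^ q^-1)%E].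

Definition Lp_loc p : set (X -> R) :=
  [set f | measurable_fun [set: X] f /\
    forall x r, 0 < r -> f \_ (ball x r) \in Lfun mu p%:E].

(* [mu \x mu] is the product measure: [mu] is sigma-finite under [doubling]. *)
Definition besov s p : set (X -> R) :=
  [set f | Lp_loc p f /\
    (\int[mu \x mu]_u
       (if u.1 == u.2 then 0
        else (`|f u.1 - f u.2| / mdist u.1 u.2 `^ s) `^ p
             / vol u.1 (mdist u.1 u.2))%:E < +oo)%E].

Definition besov_crit p : set (X -> R) :=
  [set f | Lp_loc p f /\
    (\int[mu \x mu]_u
       (if u.1 == u.2 then 0
        else `|f u.1 - f u.2| `^ p
             / vol u.1 (mdist u.1 u.2) ^+ 2)%:E < +oo)%E].

(* Function spaces are sets of Borel functions, not of a.e.-classes, so constancy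
   is only required a.e. *)
Definition constants : set (X -> R) :=
  [set f | measurable_fun [set: X] f /\ exists c : R, f = cst c %[ae mu]].

End metric_measure_space.

(* Main.v *)
Require Import Defs.
From HB Require Import structures.
From mathcomp Require Import all_boot all_order all_algebra.
From mathcomp Require Import all_classical all_reals all_analysis.
From mathcomp Require Import measurable_realfun lra ring.
Import Order.TTheory GRing.Theory Num.Theory.
Import numFieldNormedType.Exports.
Local Open Scope classical_set_scope.
Local Open Scope ring_scope.

(* Truncating [f] at level [N], we may assume it bounded. Let [g] be the average of
   [f] against the kernel [max 0 (1 - rho(x, .) / r)]. Since only differences
   [f y - f x] enter, doubling shows that both [|g - f| / r] and [lip g] are bounded
   at [x] by a multiple of [osc / r], where [osc] is the mean of [|f - f x|] over
   [B(x, 2 r)]. The [d]-th power of [osc / r] is in turn controlled by the part of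
   the inner Besov integral over [0 < rho(x, y) < 2 r]. Hence
   both [g - f] in [L^1(B)] and [int_B (lip g)^d] are controlled by the Besov energy
   near the diagonal, which tends to [0] with [r] by dominated convergence, and the
   Poincare inequality for [g] shows that [f] has no mean oscillation on any ball.
   The lower dimension bound makes the integrand of the second space dominate locally
   that of the first one, after a truncation which trades the exponent [d] for [p]. *)

(** * Metric measure spaces *)

Section integral_lemmas.
Set Implicit Arguments.
Unset Strict Implicit.
Local Open Scope ereal_scope.
Context d (T : measurableType d) (R : realType).
Variable mu : {measure set T -> \bar R}.

(* The integral of a nonnegative function is a supremum over the simple functions
   below it, whence the absence of measurability hypotheses. *)
Lemma le_integral_nonneg (D : set T) (f g : T -> \bar R) :
  (forall x, D x -> 0 <= f x) -> (forall x, D x -> f x <= g x) ->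
  \int[mu]_(x in D) f x <= \int[mu]_(x in D) g x.
Proof.
move=> f0 fg; rewrite !ge0_integralE//; last first.
  by move=> x Dx; exact: le_trans (f0 _ Dx) (fg _ Dx).
apply: ereal_sup_le => _ /= [h hf <-]; exists h => // x.
apply: le_trans (hf x) _; rewrite /patch; case: ifPn => // xD.
by apply: fg; rewrite inE in xD.
Qed.

End integral_lemmas.

Section metric.
Set Implicit Arguments.
Unset Strict Implicit.
Context {R : realType} {disp : measure_display} {X : borelMetricType R disp}.
Implicit Types (x y z : X) (r : R).

Lemma mem_mball x r y : ball x r y <-> mdist x y < r.
Proof. by rewrite ballEmdist. Qed.

Lemma subset_mball x x' r r' : mdist x' x + r <= r' -> ball x r `<=` ball x' r'.
Proof.
move=> h y /mem_mball xy; apply/mem_mball.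
by apply: le_lt_trans (metric_triangle x' x y) _; lra.
Qed.

Lemma open_measurable_borel (U : set X) : open U -> measurable U.
Proof. by move=> oU; rewrite measurable_borel; exact: sub_sigma_algebra. Qed.

Lemma measurable_lipschitz_fun (f : X -> R) :
  lipschitz_fun f -> measurable_fun [set: X] f.
Proof.
move=> [L Lf] _; apply: (measurability _ (RGenInftyO.measurableE R)) => //.
move=> _ [_ [a ->] <-]; rewrite setTI; apply: open_measurable_borel.
rewrite openE => x /=; rewrite in_itv/= => fxa.
(* A Lipschitz constant [L] may be zero or even negative, so the radius is obtained by dividing by
   [|L| + 1]. *)
have L0 : 0 < `|L| + 1 by rewrite ltr_wpDl.
apply/nbhs_ballP; exists ((a - f x) / (`|L| + 1)) => /=.
  by rewrite divr_gt0// subr_gt0.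
move=> y /mem_mball; rewrite ltr_pdivlMr// => xy /=; rewrite in_itv/=.
have := Lf x y; have := mdist_ge0 x y; have := ler_norm L.
have := ler_norm (- (f x - f y)); rewrite normrN.
by nra.
Qed.

Lemma lipschitz_mdist x : lipschitz_fun (mdist x).
Proof.
exists 1 => y z; rewrite mul1r ler_norml.
have := metric_triangle x y z; have := metric_triangle x z y.
by rewrite (metric_sym z y); lra.
Qed.

Lemma measurable_mball x r : measurable (ball x r).
Proof.
rewrite (_ : ball x r = [set: X] `&` mdist x @^-1` `]-oo, r[).
  exact: (measurable_lipschitz_fun (lipschitz_mdist x)).
by apply/seteqP; split => y; rewrite setTI /= in_itv/= => /mem_mball.
Qed.

Lemma bigcup_mball x : \bigcup_k ball x k%:R = [set: X].
Proof.
rewrite -subTset => y _; exists (Num.truncn (mdist x y)).+1 => //.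
by apply/mem_mball; exact: truncnS_gt.
Qed.

(* [mdist x y] is the infimum over [n] of [mdist (a n) x + mdist (a n) y]; without
   separability it need not be measurable for the product sigma-algebra. *)
Lemma measurable_mdist (a : nat -> X) :
  (forall x (e : R), 0 < e -> exists n, mdist (a n) x < e) ->
  measurable_fun [set: X * X] (fun u => mdist u.1 u.2).
Proof.
move=> da _; apply: (measurability _ (RGenInftyO.measurableE R)) => //.
move=> _ [_ [r ->] <-]; rewrite setTI.
pose g n (u : X * X) := mdist (a n) u.1 + mdist (a n) u.2.
have mg n : measurable_fun [set: X * X] (g n).
  have m := measurable_lipschitz_fun (lipschitz_mdist (a n)).
  by apply: measurable_funD; exact: (measurableT_comp m).
rewrite (_ : _ @^-1` _ = \bigcup_n ([set: X * X] `&` g n @^-1` `]-oo, r[)).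
  by apply: bigcupT_measurable => n; exact: mg.
apply/seteqP; split => [[x y]|[x y] [n _]]; rewrite /g /= in_itv/=.
  move=> xyr; have [|n an] := da x ((r - mdist x y) / 2); first by lra.
  exists n => //; split => //; rewrite /= in_itv/=.
  by have := metric_triangle (a n) x y; lra.
move=> [_]; rewrite /= in_itv/= => h.
by have := metric_triangle x (a n) y; rewrite (metric_sym x (a n)); lra.
Qed.

End metric.

(** * Volumes of balls and separability of doubling spaces *)

Section doubling_volume.
Set Implicit Arguments.
Unset Strict Implicit.
Context {R : realType} {disp : measure_display} {X : borelMetricType R disp}.
Variable mu : {measure set X -> \bar R}.
Implicit Types (x y z : X) (r : R).
Hypothesis mu_ball : forall x r, 0 < r -> (0 < mu (ball x r) < +oo)%E.
Local Notation V := (vol mu).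

Lemma volE x r : 0 < r -> mu (ball x r) = (V x r)%:E.
Proof.
by move=> /(mu_ball x) /andP[m0 moo]; rewrite fineK// ge0_fin_numE// ltW.
Qed.

Lemma vol_gt0 x r : 0 < r -> 0 < V x r.
Proof. by move=> r0; rewrite -lte_fin -volE//; case/andP: (mu_ball x r0). Qed.

Lemma le_vol x x' r r' : 0 < r -> 0 < r' -> mdist x' x + r <= r' ->
  V x r <= V x' r'.
Proof.
move=> r0 r'0 h; rewrite -lee_fin -!volE//.
by apply: le_measure; rewrite ?inE; [exact: measurable_mball..|exact: subset_mball].
Qed.

Lemma sigma_finite_mball : sigma_finite [set: X] mu.
Proof.
have [[x0 _]|nX] := pselect (exists x : X, True); last first.
  exists (fun=> set0) => [|n]; last by rewrite measure0; split.
  by rewrite bigcup0// -subset0 => x; case: nX; exists x.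
exists (fun k => ball x0 k.+1%:R) => [|k].
  apply/esym; rewrite -subTset => y _.
  have : (\bigcup_k ball x0 k%:R) y by rewrite bigcup_mball.
  move=> [k _ ky]; exists k => //; apply: subset_mball ky.
  by rewrite mdistxx add0r ler_nat.
by split; [exact: measurable_mball|case/andP: (mu_ball x0 (ltr0Sn R k))].
Qed.

(** Doubling the radius cannot decrease a positive volume. The point [x] matters: on an empty space
    every [c] satisfies the hypothesis. *)
Lemma doubling_ge1 (c : R) x : (forall x r, 0 < r -> V x (2 * r) <= c * V x r) ->
  1 <= c.
Proof.
move=> dbl; rewrite -(@ler_pM2r _ (V x 1)) ?vol_gt0// mul1r.
by apply: le_trans (dbl x 1 ltr01); apply: le_vol; rewrite ?mdistxx; lra.
Qed.

Variable c : R.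
Hypothesis dbl : forall x r, 0 < r -> V x (2 * r) <= c * V x r.

Lemma doubling_iter n x r : 0 < r -> V x (2 ^+ n * r) <= c ^+ n * V x r.
Proof.
move=> r0; have c1 := doubling_ge1 x dbl.
elim: n => [|n ih]; first by rewrite !expr0 !mul1r.
rewrite !exprS -!mulrA; apply: le_trans (dbl _ _) _.
  by rewrite mulr_gt0// exprn_gt0.
by rewrite ler_wpM2l//; lra.
Qed.

(** Packing argument. Without a finite net one can pick arbitrarily many [e]-separated points of the
    ball; the balls of radius [e / 2] around them are disjoint, lie in [ball x0 (k + e)], and by
    doubling have volumes bounded below, which contradicts the finite volume of the latter ball. *)
Lemma finite_net x0 (k e : R) : 0 < k -> 0 < e ->
  exists s : seq X, forall x, ball x0 k x -> exists2 a, a \in s & mdist a x < e.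
Proof.
move=> k0 e0; apply: contrapT => nonet.
have sep n : exists s : seq X, [/\ size s = n, {in s, forall a, ball x0 k a} &
    pairwise (fun a b => e <= mdist a b) s].
  elim: n => [|n [s [sn sk ss]]]; first by exists [::].
  apply: contrapT => nos; apply: nonet; exists s => x kx.
  apply: contrapT => nx; apply: nos; exists (x :: s); split => /=.
  - by rewrite sn.
  - by move=> a; rewrite inE => /predU1P[->//|/sk].
  - rewrite ss andbT; apply/allP => a sa; rewrite leNgt; apply/negP => xa.
    by apply: nx; exists a => //; rewrite metric_sym.
(* After [m] doublings the radius [e / 2] is at least [2 * k], so a ball centred at [a] in
   [ball x0 k] then contains all of [ball x0 k]. Hence [del] bounds the volume of [ball a (e / 2)]
   from below. *)
pose m := (Num.truncn (4 * k / e)).+1.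
pose del := V x0 k / c ^+ m.
have c1 := doubling_ge1 x0 dbl.
have del0 : 0 < del by rewrite divr_gt0 ?vol_gt0// exprn_gt0//; lra.
have mk : 4 * k / e <= 2 ^+ m.
  apply: (@le_trans _ _ m%:R); first exact/ltW/truncnS_gt.
  by rewrite -natrX ler_nat ltnW// ltn_expl.
have dele a : ball x0 k a -> del <= V a (e / 2).
  move=> /mem_mball ka; rewrite ler_pdivrMr; last by rewrite exprn_gt0//; lra.
  rewrite mulrC; apply: le_trans (doubling_iter m a _); last by lra.
  move: mk; rewrite ler_pdivrMr// => mk.
  have : 2 * k <= 2 ^+ m * (e / 2) by lra.
  move=> mk'; apply: le_vol; rewrite ?(metric_sym a); nra.
have sum (s : seq X) : {in s, forall a, ball x0 k a} ->
    pairwise (fun a b => e <= mdist a b) s ->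
    (((size s)%:R * del)%:E <= mu (\big[setU/set0]_(a <- s) ball a (e / 2)%R))%E.
  elim: s => [|a s ih] /= sk; first by rewrite big_nil mul0r.
  move=> /andP[/allP sa ss]; rewrite big_cons measureU; first 1 last.
  - exact: measurable_mball.
  - by apply: bigsetU_measurable => *; exact: measurable_mball.
  - rewrite -subset0 => y [/mem_mball ay]; rewrite -bigcup_seq => -[b /= bs].
    move=> /mem_mball by_; have := sa _ bs; rewrite leNgt => /negP; apply.
    by apply: le_lt_trans (metric_triangle a y b) _; rewrite (metric_sym y); lra.
  rewrite -natr1 mulrDl mul1r addrC EFinD leeD//.
    suff : (del%:E <= mu (ball a (e / 2)))%E by [].
    rewrite volE; last lra.
    by rewrite lee_fin dele//; apply: sk; rewrite mem_head.
  by apply: ih => // b bs; apply: sk; rewrite in_cons bs orbT.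
have [s [sn sk ss]] := sep (Num.truncn (V x0 (k + e) / del)).+1.
have := sum s sk ss; rewrite sn leNgt => /negP; apply.
apply: (@le_lt_trans _ _ (V x0 (k + e))%:E).
  rewrite -volE; last by lra.
  apply: le_measure; rewrite ?inE; [|exact: measurable_mball|].
    by apply: bigsetU_measurable => *; exact: measurable_mball.
  rewrite -bigcup_seq => y [a /= /sk /mem_mball ka]; apply: subset_mball; lra.
by rewrite lte_fin -ltr_pdivrMr// truncnS_gt.
Qed.

(** The finite nets of the balls of radius [k + 1] with mesh [1 / (n + 1)] are merged into one
    sequence through an encoding of triples of integers; meaningless codes give [x0]. This
    separability makes the distance jointly measurable. *)
Lemma dense_sequence x0 :
  exists a : nat -> X, forall x (e : R), 0 < e -> exists n, mdist (a n) x < e.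
Proof.
have /(_ _)/cid : forall kn : nat * nat, exists s : seq X, forall x,
    ball x0 kn.1.+1%:R x -> exists2 a, a \in s & mdist a x < kn.2.+1%:R^-1.
  by move=> kn; exact: finite_net.
move=> net; pose a (m : nat) : X :=
  if unpickle m is Some (k, n, i) then nth x0 (sval (net (k, n))) i else x0.
exists a => x e e0.
pose k := Num.truncn (mdist x0 x); pose n := Num.truncn e^-1.
have kx : ball x0 k.+1%:R x by apply/mem_mball; exact: truncnS_gt.
have [b bs bx] := svalP (net (k, n)) x kx.
exists (pickle (k, n, index b (sval (net (k, n))))).
rewrite /a pickleK nth_index//; apply: lt_le_trans bx _ => /=.
by rewrite invf_ple ?posrE//; exact/ltW/truncnS_gt.
Qed.

End doubling_volume.

(** * Lipschitz approximation *)

Section bounded_integrals.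
Set Implicit Arguments.
Unset Strict Implicit.
Context d (T : measurableType d) (R : realType).
Variable mu : {measure set T -> \bar R}.

Lemma integrable_EFinZl (B : set T) (k : R) (g : T -> R) : measurable B ->
  mu.-integrable B (EFin \o g) -> mu.-integrable B (EFin \o (fun x => k * g x)).
Proof.
move=> mB ig; rewrite (_ : _ \o _ = (fun x => k%:E * (EFin \o g) x)%E).
  exact: integrableZl.
by apply/funext => x /=; rewrite EFinM.
Qed.

Lemma integrable_EFinB (B : set T) (g h : T -> R) : measurable B ->
  mu.-integrable B (EFin \o g) -> mu.-integrable B (EFin \o h) ->
  mu.-integrable B (EFin \o (fun x => g x - h x)).
Proof.
move=> mB ig ih; rewrite (_ : _ \o _ = ((EFin \o g) \- (EFin \o h))%E).
  exact: integrableB.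
by apply/funext => x /=; rewrite EFinB.
Qed.

Lemma integrable_EFinD (B : set T) (g h : T -> R) : measurable B ->
  mu.-integrable B (EFin \o g) -> mu.-integrable B (EFin \o h) ->
  mu.-integrable B (EFin \o (fun x => g x + h x)).
Proof.
move=> mB ig ih; rewrite (_ : _ \o _ = ((EFin \o g) \+ (EFin \o h))%E).
  exact: integrableD.
by apply/funext => x /=; rewrite EFinD.
Qed.

Lemma integrable_le_bound (B : set T) (g : T -> R) (M : R) : measurable B ->
  (mu B < +oo)%E -> measurable_fun B g -> (forall x, B x -> `|g x| <= M) ->
  mu.-integrable B (EFin \o g).
Proof.
move=> mB Boo mg gM; apply: measurable_bounded_integrable => //.
by exists M; split; rewrite ?num_real// => M' MM' x Bx; apply: le_trans (gM x Bx) (ltW MM').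
Qed.

Lemma integrable_le_bound_supp (B : set T) (g : T -> R) (M : R) : measurable B ->
  (mu B < +oo)%E -> measurable_fun [set: T] g -> (forall x, `|g x| <= M) ->
  (forall x, ~ B x -> g x = 0) -> mu.-integrable [set: T] (EFin \o g).
Proof.
move=> mB Boo mg gM g0.
rewrite (_ : EFin \o g = (EFin \o g) \_ B).
  apply/(integrable_mkcond _ mB); apply: (@integrable_le_bound _ _ M) => //.
  exact: measurable_funS mg.
apply/funext => x; rewrite patchE; case: ifPn => // /negP xB /=.
by rewrite g0// => Bx; apply: xB; rewrite inE.
Qed.

(* A substitute for Jensen's inequality: average
   [h <= s + s `^ (1 - p) * h `^ p] with [s] half the mean of [h]. *)
Lemma half_mean_powR_le (B : set T) (h : T -> R) (M p : R) : 1 <= p ->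
  measurable B -> (0 < mu B < +oo)%E -> measurable_fun B h ->
  (forall x, B x -> 0 <= h x <= M) ->
  ((fine (mu B))^-1 * \int[mu]_(x in B) h x / 2) `^ p <=
  (fine (mu B))^-1 * \int[mu]_(x in B) h x `^ p.
Proof.
move=> p1 mB /andP[B0 Boo] mh hM.
set m := fine (mu B); set s := _ / 2.
have m0 : 0 < m by rewrite fine_gt0// B0.
have hp0 : 0 <= m^-1 * \int[mu]_(x in B) h x `^ p.
  apply: mulr_ge0; first by rewrite invr_ge0 ltW.
  by apply: Rintegral_ge0 => x _; exact: powR_ge0.
have s0 : 0 <= s.
  rewrite divr_ge0// mulr_ge0 ?invr_ge0 ?(ltW m0)//; apply: Rintegral_ge0 => x /hM.
  by case/andP.
have [->|sN0] := eqVneq s 0; first by rewrite powR0//; lra.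
have {}s0 : 0 < s by rewrite lt_neqAle eq_sym sN0.
have ih : mu.-integrable B (EFin \o h).
  apply: (@integrable_le_bound _ _ M) => // x /hM /andP[h0 hM'].
  by rewrite ger0_norm.
have ihp : mu.-integrable B (EFin \o (fun x => h x `^ p)).
  apply: (@integrable_le_bound _ _ (M `^ p)) => //.
    by apply: (measurableT_comp (measurable_powR _) mh).
  move=> x /hM /andP[h0 hM']; rewrite ger0_norm ?powR_ge0//.
  by apply: ge0_ler_powR; rewrite ?nnegrE//; lra.
have ihc : mu.-integrable B (EFin \o (fun x => s `^ (1 - p) * h x `^ p)).
  exact: integrable_EFinZl.
have is_ : mu.-integrable B (EFin \o (fun=> s)).
  by apply: (@integrable_le_bound _ _ s) => // x _; rewrite ger0_norm// ltW.
have : \int[mu]_(x in B) h x <= \int[mu]_(x in B) (s + s `^ (1 - p) * h x `^ p).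
  apply: le_Rintegral => //; first exact: integrable_EFinD.
  move=> x /hM /andP[h0 hM']; have [hs|sh] := leP (h x) s.
    by rewrite (le_trans hs)// lerDl mulr_ge0// powR_ge0.
  have h0' := lt_trans s0 sh.
  apply: (@le_trans _ _ (s `^ (1 - p) * h x `^ p)); last by rewrite lerDr ltW.
  rewrite -(opprB p 1) powRN mulrC ler_pdivlMr ?powR_gt0//.
  rewrite -(@mulr_powRB1 _ (h x) p) ?(ltW h0')//; last lra.
  by rewrite ler_pM2l//; apply: ge0_ler_powR; rewrite ?nnegrE; lra.
rewrite RintegralD// RintegralZl// Rintegral_cst// -/m.
(* As [s] is half the mean, the integral of the constant [s] absorbs exactly half of the left-hand
   side. *)
have -> : \int[mu]_(x in B) h x = 2 * s * m.
  by rewrite /s mulrC; field; rewrite gt_eqF.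
move=> h1; have {h1} : s * m <= s `^ (1 - p) * \int[mu]_(x in B) h x `^ p by lra.
have a0 : 0 < s `^ (p - 1) by rewrite powR_gt0.
rewrite -(opprB p 1) powRN ler_pdivlMl// ler_pdivlMl// -(@mulr_powRB1 _ s p) ?(ltW s0)//.
  by move=> ?; lra.
by lra.
Qed.

End bounded_integrals.

(** * Averages against a tent kernel at scale [r] *)

Section approximation.
Set Implicit Arguments.
Unset Strict Implicit.
Context {R : realType} {disp : measure_display} {X : borelMetricType R disp}.
Variable mu : {measure set X -> \bar R}.
Implicit Types (x y z : X) (r : R).
Hypothesis mu_ball : forall x r, 0 < r -> (0 < mu (ball x r) < +oo)%E.
Local Notation V := (vol mu).
Variable c : R.
Hypothesis dbl : forall x r, 0 < r -> V x (2 * r) <= c * V x r.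

Definition osc (f : X -> R) x r : R :=
  (V x r)^-1 * \int[mu]_(y in ball x r) `|f y - f x|.

Let w r x y : R := Num.max 0 (1 - mdist x y / r).

Section fixed_radius.
Variables (f : X -> R) (N r : R).
Hypotheses (mf : measurable_fun [set: X] f) (fN : forall x, `|f x| <= N).
Hypothesis r0 : 0 < r.

Let ball_lty x r' : 0 < r' -> (mu (ball x r') < +oo)%E.
Proof. by move=> /(mu_ball x)/andP[]. Qed.

Let w_ge0 x y : 0 <= w r x y.
Proof. by rewrite /w le_max lexx. Qed.

Let w_le1 x y : w r x y <= 1.
Proof. by rewrite /w ge_max ler01/= lerBlDr lerDl divr_ge0// ?mdist_ge0// ltW. Qed.

Let w_out x y : r <= mdist x y -> w r x y = 0.
Proof. by move=> h; apply/max_idPl; rewrite subr_le0 ler_pdivlMr// mul1r. Qed.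

Let mw x : measurable_fun [set: X] (w r x).
Proof.
apply: measurable_maxr => //; apply: measurable_funB => //.
apply: measurable_funM => //; exact: (measurable_lipschitz_fun (lipschitz_mdist x)).
Qed.

Let w_lip x x' y : `|w r x' y - w r x y| <= mdist x x' / r.
Proof.
have h : mdist x x' / r = `|mdist x x' / r|.
  by rewrite ger0_norm// divr_ge0 ?mdist_ge0// ltW.
have h1 := metric_triangle x x' y; have h2 := metric_triangle x' x y.
rewrite (metric_sym x' x) in h2.
have k1 : mdist x y / r <= mdist x x' / r + mdist x' y / r.
  by rewrite -mulrDl ler_pM2r ?invr_gt0.
have k2 : mdist x' y / r <= mdist x x' / r + mdist x y / r.
  by rewrite -mulrDl ler_pM2r ?invr_gt0.
have h0 : 0 <= mdist x x' / r by rewrite divr_ge0 ?mdist_ge0// ltW.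
rewrite /w ler_norml /Num.max; case: ifP => a; case: ifP => b; lra.
Qed.

Let D x := \int[mu]_y w r x y.

Let iw x : mu.-integrable [set: X] (EFin \o w r x).
Proof.
apply: (@integrable_le_bound_supp _ _ _ _ (ball x r) _ 1) => //.
- exact: measurable_mball.
- exact: ball_lty.
- by move=> y; rewrite ger0_norm.
by move=> y xy; apply: w_out; rewrite leNgt; apply/negP => ?; apply/xy/mem_mball.
Qed.

Let ifw x : mu.-integrable [set: X] (EFin \o (fun y => f y * w r x y)).
Proof.
apply: (@integrable_le_bound_supp _ _ _ _ (ball x r) _ N) => //.
- exact: measurable_mball.
- exact: ball_lty.
- exact: measurable_funM.
- by move=> y; rewrite normrM (ger0_norm (w_ge0 _ _)) (le_trans _ (fN y))// ler_piMr.
move=> y xy; rewrite w_out ?mulr0// leNgt; apply/negP => ?.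
exact/xy/mem_mball.
Qed.

Let A : R := 2 * c ^+ 3.

(** Origin of [A]: the kernel centred at [x'] is at least 1/2 on [ball x' (r / 2)], and three
    doublings of this ball give [ball x' (4 * r)], which contains [ball x (2 * r)]. *)
Let D_ge x x' : mdist x x' <= r -> V x (2 * r) <= A * D x'.
Proof.
move=> xx'; have r2 : 0 < r / 2 by rewrite divr_gt0.
have c1 := doubling_ge1 mu_ball x dbl.
have : V x' (r / 2) / 2 <= D x'.
  have -> : V x' (r / 2) / 2 = \int[mu]_(y in ball x' (r / 2)) 2^-1.
    rewrite Rintegral_cst; last exact: measurable_mball.
    by rewrite mulrC.
  rewrite Rintegral_mkcond; apply: le_Rintegral => //.
    apply: (@integrable_le_bound_supp _ _ _ _ (ball x' (r / 2)) _ 2^-1) => //.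
    - exact: measurable_mball.
    - exact: ball_lty.
    - by apply/(measurable_restrictT _ _).1 => //; exact: measurable_mball.
    - move=> y; rewrite patchE; case: ifP => _; first by rewrite ger0_norm.
      by rewrite normr0.
    - by move=> y yB; rewrite patchE ifF//; apply/negP; rewrite inE.
  move=> y _; rewrite patchE; case: ifPn => // /set_mem/mem_mball xy.
  rewrite /w le_max; apply/orP; right.
  have : mdist x' y / r < 2^-1 by rewrite ltr_pdivrMr// mulrC.
  by lra.
have : V x (2 * r) <= V x' (2 ^+ 3 * (r / 2)).
  have -> : 2 ^+ 3 * (r / 2) = 4 * r by field.
  by apply: le_vol; rewrite // ?(metric_sym x'); lra.
have := doubling_iter mu_ball dbl 3 x' r2.
have : 0 < c ^+ 3 by rewrite exprn_gt0//; lra.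
rewrite /A; move: (c ^+ 3) => C; nra.
Qed.

Let D_gt0 x : 0 < D x.
Proof.
have c1 := doubling_ge1 mu_ball x dbl.
have r0' := r0; have r20 : 0 < 2 * r by lra.
have := @D_ge x x; rewrite mdistxx (ltW r0) => /(_ isT) h.
have := lt_le_trans (vol_gt0 mu_ball x r20) h.
by rewrite pmulr_rgt0// /A mulr_gt0// exprn_gt0//; lra.
Qed.

Let g x := (\int[mu]_y (f y * w r x y)) / D x.

Let osc_int x :
  \int[mu]_(y in ball x (2 * r)) `|f y - f x| = osc f x (2 * r) * V x (2 * r).
Proof.
have r0' := r0; have r20 : 0 < 2 * r by lra.
by rewrite /osc mulrAC mulVf ?mul1r// gt_eqF// vol_gt0.
Qed.

(** Common estimate for differences of averages: it is applied with [a] equal to [f x] or [g x], and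
    with [h] the product of [f - a] with a kernel or a difference of kernels. *)
Let int_le x x' (a : R) (h : X -> R) (K : R) : 0 <= K ->
  mu.-integrable [set: X] (EFin \o h) ->
  (forall y, `|h y| <= K * `|f y - a|) ->
  (forall y, 2 * r <= mdist x y -> h y = 0) ->
  `|\int[mu]_y h y| <= K * \int[mu]_(y in ball x (2 * r)) `|f y - a|.
Proof.
move=> K0 ih hK h0; apply: le_trans (le_normr_Rintegral _ _) _ => //.
have r0' := r0; have r20 : 0 < 2 * r by lra.
have i1 : mu.-integrable (ball x (2 * r)) (EFin \o (fun y => `|f y - a|)).
  apply: (@integrable_le_bound _ _ _ _ _ _ (N + `|a|)) => //.
  - exact: measurable_mball.
  - exact: ball_lty.
  - apply: measurableT_comp => //; apply: measurable_funB => //.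
    exact: measurable_funS mf.
  - move=> y _; rewrite normr_id (le_trans (ler_normB _ _))// lerD2r//.
rewrite -RintegralZl//; last exact: measurable_mball.
rewrite [leRHS]Rintegral_mkcond; apply: le_Rintegral => //.
- exact: (integrable_norm ih).
- rewrite (_ : EFin \o _ =
    ((EFin \o (fun y => K * `|f y - a|)) \_ (ball x (2 * r)))).
    apply/(integrable_mkcond _ (measurable_mball x (2 * r))).
    by apply: integrable_EFinZl => //; exact: measurable_mball.
  by rewrite restrict_EFin.
- move=> y _; rewrite patchE; case: ifPn => // /negP yB; rewrite h0 ?normr0//.
  by rewrite leNgt; apply/negP => xy; apply: yB; rewrite inE; exact/mem_mball.
Qed.

Let g_near x : `|g x - f x| <= A * osc f x (2 * r).
Proof.
have r0' := r0; have r20 : 0 < 2 * r by lra.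
have V0 := vol_gt0 mu_ball x r20.
(* The kernel has total mass [D x], so the constant [f x] can be moved under the integral. *)
have e : (g x - f x) * D x = \int[mu]_y ((f y - f x) * w r x y).
  rewrite mulrBl divfK ?gt_eqF// -RintegralZl// -RintegralB//; last exact: integrable_EFinZl.
  by apply: eq_Rintegral => y _; rewrite mulrBl.
have : `|g x - f x| * D x <= 1 * \int[mu]_(y in ball x (2 * r)) `|f y - f x|.
  rewrite -[D x in leLHS](gtr0_norm (D_gt0 x)) -normrM e; apply: int_le => //.
  - rewrite (_ : (fun y => _) = (fun y => f y * w r x y - f x * w r x y)).
      by apply: integrable_EFinB => //; exact: integrable_EFinZl.
    by apply/funext => y; rewrite mulrBl.
  - by move=> y; rewrite normrM mul1r (ger0_norm (w_ge0 _ _)) ler_piMr.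
  - by move=> y xy; rewrite w_out ?mulr0//; lra.
rewrite mul1r osc_int; have := @D_ge x x; rewrite mdistxx (ltW r0) => /(_ isT).
have : 0 <= osc f x (2 * r).
  by rewrite mulr_ge0 ?invr_ge0 ?(ltW V0)//; apply: Rintegral_ge0.
move: (osc _ _ _) `|_| (D_gt0 x) => o a D0 o0 VD aD.
rewrite -(ler_pM2r D0); apply: le_trans aD _.
by rewrite mulrAC [leRHS]mulrC ler_wpM2l.
Qed.

Let g_lip x x' : mdist x x' <= r ->
  `|g x' - g x| <= mdist x x' / r * (A * (1 + A) * osc f x (2 * r)).
Proof.
move=> xx'; have r0' := r0; have r20 : 0 < 2 * r by lra.
have V0 := vol_gt0 mu_ball x r20.
(* Because [g x * D x] is the integral of [f] against the kernel at [x], subtracting [g x] from [f]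
   absorbs the change of normalisation from [D x] to [D x']. Only a difference of kernels remains,
   of size at most [mdist x x' / r]. *)
have e : (g x' - g x) * D x' =
    \int[mu]_y ((f y - g x) * (w r x' y - w r x y)).
  transitivity (\int[mu]_y (f y * w r x' y) - \int[mu]_y (f y * w r x y) -
     (\int[mu]_y (g x * w r x' y) - \int[mu]_y (g x * w r x y))).
    rewrite !RintegralZl// -/(D x) -/(D x') mulrBl {1}/g divfK ?gt_eqF//.
    by rewrite [g x * D x]divfK ?gt_eqF//; lra.
  rewrite -!RintegralB//; do ?[exact: integrable_EFinB|exact: integrable_EFinZl].
    by apply: eq_Rintegral => y _; ring.
  by apply: integrable_EFinB => //; exact: integrable_EFinZl.
set t := mdist x x' / r.
have t0 : 0 <= t by rewrite divr_ge0 ?mdist_ge0// ltW.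
have h1 : `|g x' - g x| * D x' <=
    t * \int[mu]_(y in ball x (2 * r)) `|f y - g x|.
  rewrite -[D x' in leLHS](gtr0_norm (D_gt0 x')) -normrM e; apply: int_le => //.
  - rewrite (_ : (fun y => _) = (fun y => (f y * w r x' y - f y * w r x y) -
      (g x * w r x' y - g x * w r x y))); last by apply/funext => y; ring.
    apply: integrable_EFinB => //; first exact: integrable_EFinB.
    by apply: integrable_EFinB => //; exact: integrable_EFinZl.
  - by move=> y; rewrite normrM mulrC ler_wpM2r.
  - move=> y xy; rewrite !w_out ?subrr ?mulr0//; first lra.
    by have := metric_triangle x x' y; lra.
(* Exchanging [g x] for [f x] costs [A] times the oscillation by [g_near], whence the factor
   [1 + A]. *)
have h2 : \int[mu]_(y in ball x (2 * r)) `|f y - g x| <=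
    (1 + A) * osc f x (2 * r) * V x (2 * r).
  have mB := @measurable_mball _ _ X x (2 * r).
  have i1 a : mu.-integrable (ball x (2 * r)) (EFin \o (fun y => `|f y - a|)).
    apply: (@integrable_le_bound _ _ _ _ _ _ (N + `|a|)) => //.
    - exact: ball_lty.
    - apply: measurableT_comp => //; apply: measurable_funB => //.
      exact: measurable_funS mf.
    - by move=> y _; rewrite normr_id (le_trans (ler_normB _ _))// lerD2r.
  have i2 : mu.-integrable (ball x (2 * r)) (EFin \o (fun y => `|f x - g x|)).
    by apply: (@integrable_le_bound _ _ _ _ _ _ `|f x - g x|) => //;
      [exact: ball_lty|move=> y _; rewrite normr_id].
  apply: (@le_trans _ _
      (\int[mu]_(y in ball x (2 * r)) (`|f y - f x| + `|f x - g x|))).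
    apply: le_Rintegral => //; first exact: integrable_EFinD.
    by move=> y _; exact: ler_distD.
  rewrite RintegralD// osc_int Rintegral_cst// -mulrDl ler_pM2r//.
  by have := g_near x; rewrite distrC; lra.
have hD := D_ge xx'.
have o0 : 0 <= osc f x (2 * r).
  by rewrite mulr_ge0 ?invr_ge0 ?(ltW V0)//; apply: Rintegral_ge0.
have c1 := doubling_ge1 mu_ball x dbl.
have A0 : 0 < A by rewrite /A mulr_gt0// exprn_gt0//; lra.
rewrite -(ler_pM2r (D_gt0 x')); apply: le_trans h1 _.
rewrite -[leRHS]mulrA ler_wpM2l//; apply: le_trans h2 _.
have -> : A * (1 + A) * osc f x (2 * r) * D x' =
   (1 + A) * osc f x (2 * r) * (A * D x') by ring.
by rewrite ler_wpM2l// mulr_ge0//; lra.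
Qed.

Let osc_le x : osc f x (2 * r) <= 2 * N.
Proof.
have r0' := r0; have r20 : 0 < 2 * r by lra.
have V0 := vol_gt0 mu_ball x r20.
rewrite -(ler_pM2r V0) -osc_int.
have mB := @measurable_mball _ _ X x (2 * r).
rewrite -[leRHS]/(2 * N * fine _) -Rintegral_cst//; apply: le_Rintegral => //.
- apply: (@integrable_le_bound _ _ _ _ _ _ (2 * N)) => //.
  + exact: ball_lty.
  + apply: measurableT_comp => //; apply: measurable_funB => //.
    exact: measurable_funS mf.
  + move=> y _; rewrite normr_id (le_trans (ler_normB _ _))//.
    by have := fN x; have := fN y; lra.
- by apply: (@integrable_le_bound _ _ _ _ _ _ `|2 * N|) => //; exact: ball_lty.
move=> y _; rewrite (le_trans (ler_normB _ _))//.
by have := fN x; have := fN y; lra.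
Qed.

(** The global Lipschitz property serves to make the Poincare inequality applicable, and its
    constant depends on [N] and [r]. The quantitative content is in the two bounds by the
    oscillation. *)
Lemma lipschitz_approximation : exists g : X -> R, [/\ lipschitz_fun g,
  forall x, `|g x - f x| <= A * osc f x (2 * r) &
  forall x x', mdist x x' <= r ->
    `|g x' - g x| <= mdist x x' / r * (A * (1 + A) * osc f x (2 * r))].
Proof.
exists g; split => //.
have [[x0 _]|nX] := pselect (exists x : X, True); last first.
  by exists 0 => x; case: nX; exists x.
have c1 := doubling_ge1 mu_ball x0 dbl.
have A0 : 0 < A by rewrite /A mulr_gt0// exprn_gt0//; lra.
have N0 : 0 <= N by apply: le_trans (fN x0).
(* The last summand handles points at distance at most [r], through [g_lip]. The others bound
   [|g x - g x'|] outright, which suffices for distant points because [mdist x x' / r] is then at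
   least 1. *)
pose L := 2 * N + 2 * (A * (2 * N)) + A * (1 + A) * (2 * N).
exists (L / r) => x x'; rewrite distrC mulrAC -mulrA mulrC.
have t0 : 0 <= mdist x x' / r by rewrite divr_ge0 ?mdist_ge0// ltW.
have AN : 0 <= A * (2 * N) by rewrite mulr_ge0 ?(ltW A0) ?mulr_ge0.
have AA : 0 <= A * (1 + A) by rewrite mulr_ge0 ?(ltW A0)//; lra.
have AAN : 0 <= A * (1 + A) * (2 * N) by rewrite mulr_ge0// mulr_ge0.
have o := osc_le x; have o' := osc_le x'.
have [xx'|xx'] := leP (mdist x x') r.
  apply: le_trans (g_lip xx') _; rewrite ler_wpM2l//.
  apply: (@le_trans _ _ (A * (1 + A) * (2 * N))); last by rewrite /L; lra.
  by rewrite ler_wpM2l.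
have t1 : 1 <= mdist x x' / r by rewrite ler_pdivlMr// mul1r ltW.
apply: (@le_trans _ _ L); last by rewrite ler_peMl// /L; lra.
have gf := g_near x; have gf' := g_near x'.
have Ao : A * osc f x (2 * r) <= A * (2 * N) by rewrite ler_pM2l.
have Ao' : A * osc f x' (2 * r) <= A * (2 * N) by rewrite ler_pM2l.
have fx := fN x; have fx' := fN x'.
rewrite /L; move: AAN; move: (A * (1 + A) * _) (A * (2 * N)) Ao Ao' gf gf' fx fx'.
move=> K K'; rewrite !ler_norml => ? ? /andP[? ?] /andP[? ?] /andP[? ?] /andP[? ?].
by move=> ?; lra.
Qed.

End fixed_radius.
End approximation.

(** * Besov energy near the diagonal *)

Section pointwise_lipschitz.
Set Implicit Arguments.
Unset Strict Implicit.
Context {R : realType} {disp : measure_display} {X : borelMetricType R disp}.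
Implicit Types (x y : X) (r K : R).

(** At every scale [t > 0] the point [x] itself contributes 0 to the supremum. *)
Lemma lip_ge0 (g : X -> R) x : (0 <= lip g x)%E.
Proof.
rewrite /lip limf_einfE.
set h := fun t : R => _.
apply: (@le_trans _ _ (ereal_inf (h @` [set t : R | 0 < t]))); last first.
  by apply: ereal_sup_ubound; exists [set t : R | 0 < t] => //; exact: nbhs_right_gt.
apply: le_ereal_inf_tmp => _ /= [t t0 <-]; apply: ereal_sup_ubound.
by exists x; rewrite /= ?mdistxx ?ltW// subrr normr0 mul0r.
Qed.

(** At each scale [0 < t <= r] the difference quotients are at most [K / r], and every right
    neighbourhood of 0 contains such a [t]. *)
Lemma lip_le (g : X -> R) x r K : 0 < r -> 0 <= K ->
  (forall y, mdist x y <= r -> `|g y - g x| <= mdist x y / r * K) ->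
  (lip g x <= (K / r)%:E)%E.
Proof.
move=> r0 K0 gK.
rewrite /lip limf_einfE; apply: ge_ereal_sup => _ /= [U /= nU <-].
have [t [Ut [/= t0 tr]]] : exists t, (U `&` ([set t | 0 < t] `&` [set t | t <= r])) t.
  apply: (@filter_ex _ ((0 : R)^'+)); apply: filterI => //.
  by apply: filterI; [exact: nbhs_right_gt|exact: nbhs_right_le].
apply: (@le_trans _ _ (ereal_sup
    [set (`|g x - g y| / t)%:E | y in [set y | mdist x y <= t]])).
  by apply: ereal_inf_lbound; exists t.
apply: ge_ereal_sup => _ /= [y xyt <-]; rewrite lee_fin ler_pdivrMr// distrC.
apply: le_trans (gK y (le_trans xyt tr)) _.
have -> : K / r * t = t / r * K by ring.
by rewrite ler_wpM2r// ler_wpM2r// invr_ge0 ltW.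
Qed.

End pointwise_lipschitz.

Section besov_kernel.
Set Implicit Arguments.
Unset Strict Implicit.
Context {R : realType} {disp : measure_display} {X : borelMetricType R disp}.
Variable mu : {sigma_finite_measure set X -> \bar R}.
Implicit Types (x y z : X) (r : R).
Hypothesis mu_ball : forall x r, 0 < r -> (0 < mu (ball x r) < +oo)%E.
Local Notation V := (vol mu).
Variable c : R.
Hypothesis dbl : forall x r, 0 < r -> V x (2 * r) <= c * V x r.
Variables (f : X -> R) (N d : R) (E : set X).
Hypotheses (mf : measurable_fun [set: X] f) (fN : forall x, `|f x| <= N).
Hypotheses (d1 : 1 <= d) (mE : measurable E).

(** The Besov integrand with its weight frozen at scale [r]: within distance [r], both [r] and
    [V u.1 r] exceed the distance and the volume they replace. The set [E] localises the first
    variable. *)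
Definition besov_kernel r (u : X * X) : R :=
  \1_[set u : X * X | E u.1 /\ mdist u.1 u.2 < r] u *
  (`|f u.1 - f u.2| `^ d / (r `^ d * V u.1 r)).

Lemma besov_kernel_ge0 r u : 0 <= besov_kernel r u.
Proof. by rewrite mulr_ge0// mulr_ge0 ?powR_ge0// invr_ge0 mulr_ge0 ?powR_ge0// fine_ge0. Qed.

Lemma besov_kernel0 r u : r <= mdist u.1 u.2 -> besov_kernel r u = 0.
Proof. by move=> h; rewrite /besov_kernel indicE memNset ?mul0r//= => -[_]; rewrite ltNge h. Qed.

Lemma measurable_mdist_lt x0 r :
  measurable [set u : X * X | mdist u.1 u.2 < r].
Proof.
have [a da] := dense_sequence mu_ball dbl x0.
have := measurable_mdist da measurableT (measurable_itv `]-oo, r[).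
by rewrite setTI.
Qed.

(** The ball is a section of the measurable set of pairs at distance less than [r], and the measure
    of sections is a measurable function. *)
Lemma measurable_vol r : measurable_fun [set: X] (V^~ r).
Proof.
have [[x0 _]|nX] := pselect (exists x : X, True); last first.
  move=> _ Y _; rewrite (_ : _ `&` _ = set0)// -subset0 => x.
  by case: nX; exists x.
apply: measurableT_comp => //.
have := measurable_fun_xsection mu (measurable_mdist_lt x0 r).
congr (measurable_fun _ _); apply/funext => x /=; congr (mu _).
by apply/seteqP; split => y; [move=> /xsectionP /mem_mball|move=> /mem_mball ?; apply/xsectionP].
Qed.

Lemma measurable_besov_kernel r : measurable_fun [set: X * X] (besov_kernel r).
Proof.
have [[x0 _]|nX] := pselect (exists x : X, True); last first.
  move=> _ Y _; rewrite (_ : _ `&` _ = set0)// -subset0 => -[x y] _.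
  by case: nX; exists x.
have m1 (g : X -> R) : measurable_fun [set: X] g ->
    measurable_fun [set: X * X] (fun u => g u.1).
  by move=> mg; exact: (measurableT_comp mg).
have m2 (g : X -> R) : measurable_fun [set: X] g ->
    measurable_fun [set: X * X] (fun u => g u.2).
  by move=> mg; exact: (measurableT_comp mg).
apply: measurable_funM.
  apply: measurable_indic.
  rewrite (_ : [set _ | _] = (E `*` setT) `&` [set u : X * X | mdist u.1 u.2 < r]).
    by apply: measurableI; [exact: measurableX|exact: measurable_mdist_lt].
  by apply/seteqP; split => u /= [] => [? ?|[? _] ?]; split.
apply: measurable_funM.
  apply: (measurableT_comp (measurable_powR d)).
  by apply: measurableT_comp => //; apply: measurable_funB; [exact: m1|exact: m2].
apply: (m1 (fun x => (r `^ d * V x r)^-1)).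
rewrite (_ : (fun x => _) = (fun x => (r `^ d * V x r) `^ (-1))); last first.
  by apply/funext => x; rewrite powR_inv1// mulr_ge0 ?powR_ge0// fine_ge0.
apply: (measurableT_comp (measurable_powR _)).
by apply: measurable_funM => //; exact: measurable_vol.
Qed.

Lemma osc_le_besov_kernel x r : E x -> 0 < r ->
  (((osc mu f x r / (2 * r)) `^ d)%:E <= \int[mu]_y (besov_kernel r (x, y))%:E)%E.
Proof.
move=> Ex r0; have V0 := vol_gt0 mu_ball x r0.
have mB := @measurable_mball _ _ X x r.
have /andP[B0 Boo] := mu_ball x r0.
have rd0 : 0 < r `^ d by rewrite powR_gt0.
have bnd y : 0 <= `|f y - f x| <= 2 * N.
  rewrite normr_ge0 (le_trans (ler_normB _ _))//.
  by have := fN x; have := fN y; lra.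
have mfx : measurable_fun (ball x r) (fun y => `|f y - f x|).
  apply: measurableT_comp => //; apply: measurable_funB => //.
  exact: measurable_funS mf.
have := half_mean_powR_le d1 mB (mu_ball x r0) mfx (fun y _ => bnd y).
rewrite -/(osc mu f x r) -[fine _]/(V x r) => h.
have -> : (\int[mu]_y (besov_kernel r (x, y))%:E =
    \int[mu]_(y in ball x r) (`|f y - f x| `^ d / (r `^ d * V x r))%:E)%E.
  rewrite [RHS]integral_mkcond; apply: eq_integral => y _.
  rewrite patchE /besov_kernel indicE/=; case: ifPn => [/set_mem/mem_mball xy|/negP xy].
    by rewrite mem_set// mul1r distrC.
  by rewrite memNset ?mul0r//= => -[_ ?]; apply: xy; rewrite inE; exact/mem_mball.
have i1 : mu.-integrable (ball x r) (EFin \o (fun y => `|f y - f x| `^ d)).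
  apply: (@integrable_le_bound _ _ _ _ _ _ ((2 * N) `^ d)) => //.
    exact: (measurableT_comp (measurable_powR d) mfx).
  move=> y _; rewrite ger0_norm ?powR_ge0//; have /andP[b0 b2] := bnd y.
  by apply: ge0_ler_powR; rewrite ?nnegrE//; [have := d1; lra|exact: le_trans b2].
have -> : (\int[mu]_(y in ball x r) (`|f y - f x| `^ d / (r `^ d * V x r))%:E =
    ((V x r)^-1 * (\int[mu]_(y in ball x r) (`|f y - f x| `^ d)%R) / r `^ d)%:E)%E.
  transitivity (\int[mu]_(y in ball x r) ((r `^ d * V x r)^-1 * `|f y - f x| `^ d)%:E)%E.
    by apply: eq_integral => y _; rewrite mulrC.
  have i2 := integrable_EFinZl ((r `^ d * V x r)^-1) mB i1.
  rewrite -[LHS]fineK; last exact: integrable_fin_num i2.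
  rewrite -[fine _]/(\int[mu]_(y in _) _)%R RintegralZl// invfM; congr EFin.
  by rewrite /Rintegral; ring.
rewrite lee_fin.
have -> : osc mu f x r / (2 * r) = osc mu f x r / 2 / r by rewrite invfM mulrA.
rewrite powRM ?invr_ge0 ?(ltW r0)//; last first.
  rewrite divr_ge0// mulr_ge0 ?invr_ge0 ?(ltW V0)//; exact: Rintegral_ge0.
by rewrite -[r^-1]powR_inv1 ?(ltW r0)// -powRrM mulN1r powRN ler_pM2r ?invr_gt0.
Qed.

Variables (Phi : X * X -> \bar R) (R0 : R).
Hypotheses (Phi_ge0 : forall u, (0 <= Phi u)%E)
  (Phi_fin : (\int[mu \x mu]_u Phi u < +oo)%E) (R0_gt0 : 0 < R0)
  (Phi_ge : forall x y, E x -> 0 < mdist x y < R0 ->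
     ((`|f x - f y| `^ d / (mdist x y `^ d * V x (mdist x y)))%:E <= Phi (x, y))%E).

(** Powers and volumes increase with the radius, so freezing the weight only lowers the integrand.
    On the diagonal the kernel vanishes with the difference of [f]. *)
Lemma besov_kernel_le r u : r <= R0 -> ((besov_kernel r u)%:E <= Phi u)%E.
Proof.
case: u => x y rR0; have [ry|yr] := leP r (mdist x y); first by rewrite besov_kernel0.
rewrite /besov_kernel indicE/=; have [[Ex _]|nE] := pselect (E x /\ mdist x y < r); last first.
  by rewrite memNset// mul0r.
rewrite mem_set// mul1r.
have [xy0|xy0] := eqVneq x y.
  by rewrite xy0 subrr normr0 powR0 ?mul0r// gt_eqF//; have := d1; lra.
have p0 : 0 < mdist x y by rewrite mdist_gt0.
have r0 := lt_trans p0 yr.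
apply: le_trans (Phi_ge Ex _); last by rewrite p0 (lt_le_trans yr).
have V0 := vol_gt0 mu_ball x p0; have V0' := vol_gt0 mu_ball x r0.
rewrite lee_fin ler_wpM2l ?powR_ge0// lef_pV2 ?posrE ?mulr_gt0 ?powR_gt0//.
apply: ler_pM; rewrite ?powR_ge0 ?(ltW V0)//.
  by apply: ge0_ler_powR; rewrite ?nnegrE ?(ltW p0) ?(ltW r0) ?(ltW yr)//; have := d1; lra.
by apply: le_vol => //; rewrite mdistxx add0r ltW.
Qed.

(** Dominated convergence: off the diagonal the kernel is eventually 0, and on it the kernel is
    always 0. *)
Lemma besov_kernel_cvg0 :
  (\int[mu \x mu]_u (besov_kernel (R0 / n.+1%:R) u)%:E)%E @[n --> \oo] --> (0 : \bar R)%E.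
Proof.
pose k n (u : X * X) := (besov_kernel (R0 / n.+1%:R) u)%:E.
have mk n : measurable_fun [set: X * X] (k n).
  by apply/measurable_EFinP; exact: measurable_besov_kernel.
have le1 n : R0 / n.+1%:R <= R0.
  by rewrite ler_pdivrMr// ler_peMr ?ler1n// ltW.
(* [Phi] need not be measurable, so the dominating function is the supremum of the kernels, which is
   measurable and lies below [Phi]. *)
pose K (u : X * X) := esups (k ^~ u) 0.
have kK n u : (k n u <= K u)%E by apply: ereal_sup_ubound; exists n.
have K0 u : (0 <= K u)%E by apply: le_trans (kK 0 u); rewrite lee_fin besov_kernel_ge0.
have KPhi u : (K u <= Phi u)%E.
  by apply: ge_ereal_sup => _ [n _ <-]; exact: besov_kernel_le.
have mK : measurable_fun [set: X * X] K by exact: measurable_fun_esups.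
have iK : (mu \x mu)%E.-integrable [set: X * X] K.
  apply/integrableP; split => //; under eq_integral do rewrite gee0_abs//.
  exact: le_lt_trans (le_integral_nonneg _ (fun u _ => K0 u) (fun u _ => KPhi u)) Phi_fin.
have k0 u : k ^~ u @ \oo --> (0 : \bar R)%E.
  apply: cvg_near_cst; have [xy|xy] := leP (mdist u.1 u.2) 0.
    apply: nearW => n; rewrite /k /besov_kernel (_ : u.1 = u.2).
      rewrite subrr normr0 powR0 ?mul0r ?mulr0// gt_eqF//; have := d1; lra.
    by apply: mdist_positivity; apply/eqP; rewrite eq_le xy mdist_ge0.
  exists (Num.truncn (R0 / mdist u.1 u.2)) => // n /= hn.
  rewrite /k besov_kernel0// ler_pdivrMr// mulrC -ler_pdivrMr// ltW//.
  by apply: lt_le_trans (truncnS_gt _) _; rewrite ler_nat ltnS.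
have := @dominated_convergence _ _ _ (mu \x mu)%E setT measurableT k (cst 0%E) K mk.
case=> //.
- by apply: aeW => u _; exact: k0.
- by apply: aeW => u n _; rewrite gee0_abs ?kK// lee_fin besov_kernel_ge0.
by move=> _ _; rewrite integral0.
Qed.

End besov_kernel.

(** * Vanishing of the mean oscillation *)

Section mean_deviation.
Set Implicit Arguments.
Unset Strict Implicit.
Context d (T : measurableType d) (R : realType).
Variable mu : {measure set T -> \bar R}.

(** Triangle inequality through [g x] and [m g]. The integral of [|g - f|] occurs twice because it
    also controls the difference of the two means. *)
Lemma mean_deviation_le (B : set T) (f g : T -> R)
    (m := fun h : T -> R => (fine (mu B))^-1 * \int[mu]_(x in B) h x) :
  measurable B ->
  (0 < mu B < +oo)%E ->
  mu.-integrable B (EFin \o f) -> mu.-integrable B (EFin \o g) ->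
  \int[mu]_(x in B) `|f x - m f| <=
  2 * \int[mu]_(x in B) `|g x - f x| + \int[mu]_(x in B) `|g x - m g|.
Proof.
move=> mB /andP[B0 Boo] if_ ig.
have V0 : 0 < fine (mu B) by rewrite fine_gt0// B0.
have ic (a : R) : mu.-integrable B (EFin \o (fun=> a)).
  by apply: (@integrable_le_bound _ _ _ _ _ _ `|a|).
have inorm (h : T -> R) : mu.-integrable B (EFin \o h) ->
    mu.-integrable B (EFin \o (fun x => `|h x|)).
  by move=> ih; exact: (integrable_norm ih).
have igf : mu.-integrable B (EFin \o (fun x => `|g x - f x|)).
  by apply: inorm; exact: integrable_EFinB.
have igm : mu.-integrable B (EFin \o (fun x => `|g x - m g|)).
  by apply: inorm; exact: integrable_EFinB.
have mm : `|m g - m f| * fine (mu B) <= \int[mu]_(x in B) `|g x - f x|.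
  rewrite /m -mulrBr normrM gtr0_norm ?invr_gt0// mulrAC mulVf ?gt_eqF// mul1r.
  rewrite -RintegralB//; apply: le_normr_Rintegral => //.
  exact: integrable_EFinB.
apply: (@le_trans _ _ (\int[mu]_(x in B)
    (`|g x - f x| + `|g x - m g| + `|m g - m f|))).
  apply: le_Rintegral => //.
  - by apply: inorm; exact: integrable_EFinB.
  - by apply: integrable_EFinD => //; exact: integrable_EFinD.
  move=> x _; rewrite (distrC (g x) (f x)).
  apply: le_trans (ler_distD (g x) _ _) _.
  by rewrite -addrA lerD2l ler_distD.
rewrite RintegralD//; last exact: integrable_EFinD.
by rewrite RintegralD// Rintegral_cst//; lra.
Qed.

End mean_deviation.

Section vanishing_oscillation.
Set Implicit Arguments.
Unset Strict Implicit.
Context {R : realType} {disp : measure_display} {X : borelMetricType R disp}.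
Variable mu : {sigma_finite_measure set X -> \bar R}.
Implicit Types (x y z : X) (r : R).
Hypothesis mu_ball : forall x r, 0 < r -> (0 < mu (ball x r) < +oo)%E.
Local Notation V := (vol mu).
Variable c : R.
Hypothesis dbl : forall x r, 0 < r -> V x (2 * r) <= c * V x r.
Variables (f : X -> R) (N d : R).
Hypotheses (mf : measurable_fun [set: X] f) (fN : forall x, `|f x| <= N).
Hypothesis d1 : 1 <= d.
Variables (z : X) (s lambda cP : R).
Hypotheses (s0 : 0 < s) (lambda1 : 1 <= lambda) (cP0 : 0 < cP).
Hypothesis poincare_zs : forall g : X -> R, lipschitz_fun g ->
  (((V z s)^-1)%:E * \int[mu]_(x in ball z s) (`|g x - mean mu g z s|)%:E
   <= (cP * s)%:E * (((V z (lambda * s))^-1)%:E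
     * \int[mu]_(x in ball z (lambda * s)) (lip g x `^ d)) `^ d^-1)%E.

Let A : R := 2 * c ^+ 3.
Let energy r : \bar R :=
  (\int[mu \x mu]_u (besov_kernel mu f d (ball z (lambda * s)) r u)%:E)%E.

(** The two summands bound those of [mean_deviation_le] for the approximation [g] at scale [r]: the
    first by its distance to [f], the second by the Poincare inequality. *)
Lemma mean_oscillation_le_energy r : 0 < r -> (energy (2 * r) < +oo)%E ->
  \int[mu]_(x in ball z s) `|f x - mean mu f z s| <=
  2 * (4 * A * r * (V z s + fine (energy (2 * r)))) +
  V z s * (cP * s * ((V z (lambda * s))^-1 *
    ((4 * (A * (1 + A))) `^ d * fine (energy (2 * r)))) `^ d^-1).
Proof.
move=> r0 afin; set a := fine _; set E := ball z (lambda * s).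
have d1' := d1; have s0' := s0; have l1' := lambda1.
have d0 : 0 < d by lra.
have r20 : 0 < 2 * r by lra.
have ls0 : 0 < lambda * s by rewrite mulr_gt0//; lra.
have c1 := doubling_ge1 mu_ball z dbl.
have A0 : 0 < A by rewrite /A mulr_gt0// exprn_gt0//; lra.
have mB := @measurable_mball _ _ X z s.
have mE : measurable E := @measurable_mball _ _ X z (lambda * s).
have BE : ball z s `<=` E.
  by apply: subset_mball; rewrite mdistxx add0r ler_peMl// ltW.
have Vs0 := vol_gt0 mu_ball z s0; have VE0 := vol_gt0 mu_ball z ls0.
have /andP[B0 Boo] := mu_ball z s0.
(* The inner energy integral. By Tonelli its integral is the energy; it dominates the [d]-th power
   of the normalised oscillation [w] on [E]. *)
pose G x : \bar R := (\int[mu]_y (besov_kernel mu f d E (2 * r) (x, y))%:E)%E.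
have k0 u : (0 <= (besov_kernel mu f d E (2 * r) u)%:E)%E.
  by rewrite lee_fin besov_kernel_ge0.
have mk : measurable_fun [set: X * X] (fun u => (besov_kernel mu f d E (2 * r) u)%:E).
  by apply/measurable_EFinP; exact: (measurable_besov_kernel mu_ball dbl).
have G0 x : (0 <= G x)%E by apply: integral_ge0 => y _; exact: k0.
have mG : measurable_fun [set: X] G.
  exact: (measurable_fun_fubini_tonelli_F _ mk k0).
have Ga (D : set X) : measurable D -> (\int[mu]_(x in D) G x <= a%:E)%E.
  move=> mD; apply: (@le_trans _ _ (\int[mu]_x G x)%E).
    by apply: ge0_subset_integral.
  rewrite /a fineK; last first.
    by rewrite ge0_fin_numE//; apply: integral_ge0 => u _; exact: k0.
  by rewrite /energy (fubini_tonelli1 _ mk k0).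
have [g [glip gf gg]] := lipschitz_approximation mu_ball dbl mf fN r0.
have mg := measurable_lipschitz_fun glip.
pose w x := osc mu f x (2 * r) / (2 * (2 * r)).
have wE x : osc mu f x (2 * r) = 4 * r * w x.
  by rewrite /w; field; lra.
have w0 x : 0 <= w x.
  rewrite divr_ge0//; last lra.
  rewrite mulr_ge0 ?invr_ge0 ?(ltW (vol_gt0 mu_ball x r20))//.
  exact: Rintegral_ge0.
have wG x : E x -> ((w x `^ d)%:E <= G x)%E.
  by move=> Ex; apply: (osc_le_besov_kernel mu_ball mf fN d1).
have [L gL] := glip.
have iB (h : X -> R) M : measurable_fun [set: X] h ->
    (forall x, ball z s x -> `|h x| <= M) ->
    mu.-integrable (ball z s) (EFin \o h).
  move=> mh hM; apply: (@integrable_le_bound _ _ _ _ _ _ M) => //.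
  exact: measurable_funS mh.
have if_ : mu.-integrable (ball z s) (EFin \o f) by apply: (iB f N).
have ig : mu.-integrable (ball z s) (EFin \o g).
  apply: (iB g (`|g z| + `|L| * s)) => // x /mem_mball zx.
  have -> : g x = g z - (g z - g x) by ring.
  rewrite (le_trans (ler_normB _ _))// lerD2l (le_trans (gL _ _))//.
  rewrite (@le_trans _ _ (`|L| * mdist z x))//.
    by rewrite ler_wpM2r ?mdist_ge0// ler_norm.
  by rewrite ler_wpM2l// ltW.
have gf_le : \int[mu]_(x in ball z s) `|g x - f x| <= 4 * A * r * (V z s + a).
  have igf := integrable_norm (integrable_EFinB mB ig if_).
  have K0 : 0 <= 4 * A * r by rewrite mulr_ge0 ?(ltW r0)// mulr_ge0 ?(ltW A0).
  rewrite -lee_fin [leLHS]fineK; last exact: (integrable_fin_num _ igf).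
  apply: (@le_trans _ _ (\int[mu]_(x in ball z s) ((4 * A * r)%:E * (1 + G x)))%E).
    apply: le_integral_nonneg => // x Bx.
    apply: (@le_trans _ _ ((4 * A * r)%:E * (1 + (w x `^ d)%:E))%E); last first.
      by rewrite lee_wpmul2l ?lee_fin// leeD2l// wG//; exact: BE.
    rewrite lee_fin (le_trans (gf x))// -/A wE.
    have -> : A * (4 * r * w x) = 4 * A * r * w x by ring.
    rewrite ler_wpM2l//; case: (leP (w x) 1) => ox.
      by rewrite (le_trans ox)// lerDl powR_ge0.
    rewrite (@le_trans _ _ (w x `^ d))// ?lerDr//.
    by rewrite -{1}[w x]powRr1// ler_powR// ltW.
  have mGB : measurable_fun (ball z s) G by exact: measurable_funS mG.
  rewrite ge0_integralZl_EFin//; last 2 first.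
  - by move=> x _; rewrite adde_ge0.
  - by apply: emeasurable_funD.
  rewrite [leRHS]EFinM lee_wpmul2l ?lee_fin// ge0_integralD// [leRHS]EFinD.
  by rewrite integral_cst// mul1e leeD ?Ga// volE.
have AA : 0 <= A * (1 + A) by rewrite mulr_ge0 ?(ltW A0)//; lra.
have lipG x : E x -> (lip g x `^ d <= ((4 * (A * (1 + A))) `^ d)%:E * G x)%E.
  move=> Ex; have AA0 : 0 <= 4 * (A * (1 + A)) by rewrite mulr_ge0.
  apply: (@le_trans _ _ ((4 * (A * (1 + A)) * w x)%:E `^ d)%E).
    apply: gt0_ler_poweR; first exact: ltW.
    - by rewrite in_itv/= leey lip_ge0.
    - by rewrite in_itv/= leey lee_fin mulr_ge0.
    have -> : 4 * (A * (1 + A)) * w x = (A * (1 + A) * osc mu f x (2 * r)) / r.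
      by rewrite wE; field; rewrite gt_eqF.
    apply: lip_le => //.
      by rewrite wE mulr_ge0// mulr_ge0// mulr_ge0// ltW.
    by move=> y; exact: gg.
  rewrite poweR_EFin powRM// [leLHS]EFinM lee_wpmul2l ?lee_fin ?powR_ge0//.
  exact: wG.
have gm_le : \int[mu]_(x in ball z s) `|g x - mean mu g z s| <=
    V z s * (cP * s * ((V z (lambda * s))^-1 *
      ((4 * (A * (1 + A))) `^ d * a)) `^ d^-1).
  have ic : mu.-integrable (ball z s) (EFin \o (fun=> mean mu g z s)).
    by apply: (iB (fun=> _) `|mean mu g z s|).
  have igm := integrable_norm (integrable_EFinB mB ig ic).
  have a0 : 0 <= a by rewrite fine_ge0//; apply: integral_ge0 => u _; exact: k0.
  rewrite -ler_pdivrMl// -lee_fin EFinM [X in (_ * X <= _)%E]fineK; last first.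
    exact: (integrable_fin_num _ igm).
  apply: le_trans (poincare_zs glip) _.
  rewrite [leRHS]EFinM lee_wpmul2l//; first by rewrite lee_fin mulr_ge0 // ltW.
  rewrite -poweR_EFin; apply: gt0_ler_poweR; first by rewrite invr_ge0 ltW.
  - rewrite in_itv/= leey andbT mule_ge0// ?lee_fin ?invr_ge0 ?(ltW VE0)//.
    by apply: integral_ge0 => x _; exact: poweR_ge0.
  - rewrite in_itv/= leey andbT lee_fin !mulr_ge0 ?powR_ge0 ?invr_ge0 ?(ltW VE0)//.
  rewrite [leRHS]EFinM lee_wpmul2l ?lee_fin ?invr_ge0 ?(ltW VE0)//.
  apply: (@le_trans _ _
      (\int[mu]_(x in E) (((4 * (A * (1 + A))) `^ d)%:E * G x))%E).
    by apply: le_integral_nonneg => x Ex; [exact: poweR_ge0|exact: lipG].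
  have mGE : measurable_fun E G by exact: measurable_funS mG.
  rewrite ge0_integralZl_EFin// ?powR_ge0//.
  by rewrite [leRHS]EFinM lee_wpmul2l ?lee_fin ?powR_ge0// Ga.
have := mean_deviation_le mB (mu_ball z s0) if_ ig.
by move=> /le_trans; apply; apply: lerD => //; rewrite ler_wpM2l.
Qed.

(** Let the scale tend to 0 in [mean_oscillation_le_energy]: the first summand vanishes through its
    factor [r], the second through the energy. *)
Lemma mean_oscillation0 (Phi : X * X -> \bar R) (R0 : R) :
  (forall u, (0 <= Phi u)%E) -> (\int[mu \x mu]_u Phi u < +oo)%E -> 0 < R0 ->
  (forall x y, ball z (lambda * s) x -> 0 < mdist x y < R0 ->
    ((`|f x - f y| `^ d / (mdist x y `^ d * V x (mdist x y)))%:E <= Phi (x, y))%E) ->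
  \int[mu]_(x in ball z s) `|f x - mean mu f z s| = 0.
Proof.
move=> Phi0 Phioo R00 PhiK.
have d1' := d1; have s0' := s0; have l1' := lambda1; have cP0' := cP0.
have ls0 : 0 < lambda * s by rewrite mulr_gt0//; lra.
have c1 := doubling_ge1 mu_ball z dbl.
have A0 : 0 < A by rewrite /A mulr_gt0// exprn_gt0//; lra.
have Vs0 := vol_gt0 mu_ball z s0; have VE0 := vol_gt0 mu_ball z ls0.
have mE := @measurable_mball _ _ X z (lambda * s).
set b := \int[mu]_(x in _) _.
have b0 : 0 <= b by exact: Rintegral_ge0.
pose C := (V z (lambda * s))^-1 * (4 * (A * (1 + A))) `^ d.
have C0 : 0 <= C by rewrite mulr_ge0 ?powR_ge0// invr_ge0 ltW.
pose K := 2 * (4 * A * (V z s + 1)) + V z s * (cP * s).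
have K0 : 0 < K.
  have h1 : 0 < A * (V z s + 1) by rewrite mulr_gt0//; lra.
  have h2 : 0 < V z s * (cP * s) by rewrite !mulr_gt0.
  by rewrite /K; lra.
suff bK (eta : R) : 0 < eta -> b <= eta * K.
  apply/eqP; rewrite eq_le b0 andbT; apply/ler_addgt0Pl => e e0.
  by rewrite addr0 -[e](@divfK _ K) ?gt_eqF//; apply: bK; rewrite divr_gt0.
move=> eta0.
have C10 : 0 < C + 1 by lra.
pose del := Num.min 1 (eta `^ d / (C + 1)).
have del0 : 0 < del by rewrite lt_min ltr01/= divr_gt0// powR_gt0.
have := besov_kernel_cvg0 mu_ball dbl mf d1 mE Phi0 Phioo R00 PhiK.
move=> /fine_cvgP[fink /cvgrPdist_lt /(_ _ del0) cvk].
have cvr : \forall n \near \oo, R0 / n.+1%:R < 2 * eta.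
  exists (Num.truncn (R0 / (2 * eta))) => // n /= hn.
  rewrite ltr_pdivrMr// mulrC -ltr_pdivrMr; last by lra.
  by apply: lt_le_trans (truncnS_gt _) _; rewrite ler_nat ltnS.
have [n [[/= afin adel] rn]] := filter_ex (filterI (filterI fink cvk) cvr).
set r := R0 / n.+1%:R in afin adel rn.
have r0 : 0 < r by rewrite divr_gt0.
have r20 : 0 < r / 2 by rewrite divr_gt0.
have re : 2 * (r / 2) = r by rewrite mulrC divfK.
(* Approximation at scale [r / 2] involves the energy at radius [r]. *)
have := @mean_oscillation_le_energy (r / 2) r20; rewrite re => h.
have {h} := h _; rewrite -/b => h; apply: le_trans (h _) _.
  by rewrite ltey_eq afin.
move: adel; rewrite sub0r normrN -/(energy r) ger0_norm; last first.
  by rewrite fine_ge0//; apply: integral_ge0 => u _; rewrite lee_fin besov_kernel_ge0.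
have a0 : 0 <= fine (energy r).
  by rewrite fine_ge0//; apply: integral_ge0 => u _; rewrite lee_fin besov_kernel_ge0.
move: (fine (energy r)) a0 => a a0; rewrite lt_min => /andP[a1 aeta].
have -> : eta * K = 2 * (4 * A * eta * (V z s + 1)) + V z s * (cP * s * eta).
  by rewrite /K; ring.
apply: lerD.
  have A4 : 0 < 4 * A by rewrite mulr_gt0.
  rewrite ler_pM2l//; apply: ler_pM.
  - exact: mulr_ge0 (ltW A4) (ltW r20).
  - by rewrite addr_ge0// ltW.
  - by rewrite (ler_pM2l A4) ler_pdivrMr// mulrC ltW.
  - by rewrite lerD2l ltW.
rewrite ler_pM2l// ler_pM2l ?mulr_gt0// (mulrA (V z (lambda * s))^-1) -/C.
have -> : eta = (eta `^ d) `^ d^-1.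
  by rewrite -powRrM mulfV ?gt_eqF ?powRr1 ?(ltW eta0)//; lra.
apply: ge0_ler_powR; rewrite ?nnegrE ?powR_ge0 ?(mulr_ge0 C0 a0)//.
  by rewrite invr_ge0; lra.
apply: (@le_trans _ _ ((C + 1) * a)); first by rewrite ler_wpM2r// lerDl.
by move: aeta; rewrite ltr_pdivlMr// mulrC => /ltW.
Qed.

End vanishing_oscillation.

(** * Functions constant almost everywhere *)

Section nonmeasurable_integrands.
Set Implicit Arguments.
Unset Strict Implicit.
Local Open Scope ereal_scope.
Context d (T : measurableType d) (R : realType).
Variable mu : {measure set T -> \bar R}.

Import HBNNSimple.

(** With [f] possibly nonmeasurable, one argues on simple functions: those below [k * f] are [k]
    times simple functions below [f]. *)
Lemma integralZl_lty (k : R) (f : T -> \bar R) : (0 < k)%R ->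
  (forall x, 0 <= f x) -> \int[mu]_x f x < +oo -> \int[mu]_x (k%:E * f x) < +oo.
Proof.
move=> k0 f0 foo; apply: (@le_lt_trans _ _ (k%:E * \int[mu]_x f x)); last first.
  by rewrite lte_mul_pinfty// ?lee_fin ?ltW.
rewrite ge0_integralTE => [|x]; last by rewrite mule_ge0// lee_fin ltW.
apply: ge_ereal_sup => _ /= [h hf <-].
have h0 x : (0 <= h x)%R by exact: fun_ge0.
have -> : sintegral mu h = \int[mu]_x (k%:E * (k^-1 * h x)%:E).
  rewrite -[RHS](@eq_integral _ _ _ _ _ _ (fun x => (h x)%:E)) => [|x _].
    by rewrite integral_nnsfun// patch_setT.
  by rewrite -EFinM mulrA mulfV ?gt_eqF// mul1r.
rewrite ge0_integralZl_EFin//; last exact: ltW.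
- rewrite lee_wpmul2l ?lee_fin ?(ltW k0)//; apply: le_integral_nonneg => x _.
    by rewrite lee_fin mulr_ge0// invr_ge0 ltW.
  rewrite EFinM lee_pdivrMl//; exact: hf.
- by move=> x _; rewrite lee_fin mulr_ge0// invr_ge0 ltW.
- by apply/measurable_EFinP; exact: measurable_funM.
Qed.

(** Even the function equal to [+oo] on the null set [S] has integral 0, and it dominates [f]
    without any measurability of [f]. *)
Lemma integral_null_support (S : set T) (f : T -> \bar R) : measurable S ->
  mu S = 0 -> (forall x, 0 <= f x) -> (forall x, ~ S x -> f x = 0) ->
  \int[mu]_x f x = 0.
Proof.
move=> mS S0 f0 fS; apply/eqP; rewrite eq_le integral_ge0// andbT.
have <- : \int[mu]_(x in S) `|cst +oo x| = 0 by exact: integral_abs_eq0.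
rewrite [leRHS]integral_mkcond; apply: le_integral_nonneg => // x _.
by rewrite patchE; case: ifPn => [_|/negP xS]; rewrite ?leey// fS// => Sx; apply: xS; rewrite inE.
Qed.

End nonmeasurable_integrands.

Section truncation.
Set Implicit Arguments.
Unset Strict Implicit.
Context {R : realType}.
Implicit Types (N x y : R).

Definition clip N x : R := Num.max (- N) (Num.min N x).

Lemma norm_clip_le N x : 0 <= N -> `|clip N x| <= N.
Proof. by move=> N0; rewrite ler_norml /clip le_max lexx/= ge_max ge_min lexx andbT; lra. Qed.

Lemma clip_id N x : `|x| <= N -> clip N x = x.
Proof. by rewrite ler_norml => /andP[Nx xN]; rewrite /clip (min_idPr xN) (max_idPr Nx). Qed.

Lemma clip_dist N x y : `|clip N x - clip N y| <= `|x - y|.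
Proof.
rewrite ler_norml; have := ler_norm (x - y); have := ler_norm (- (x - y)).
rewrite normrN; move: `|_| => n h1 h2.
rewrite /clip /Num.max /Num.min.
by do 4 case: ifPn; rewrite -?leNgt => *; lra.
Qed.

Lemma measurable_clip N : measurable_fun [set: R] (clip N).
Proof. by apply: measurable_maxr => //; exact: measurable_minr. Qed.

End truncation.

Section ae_constant.
Set Implicit Arguments.
Unset Strict Implicit.
Context {R : realType} {disp : measure_display} {X : borelMetricType R disp}.
Variable mu : {measure set X -> \bar R}.
Implicit Types (x y z : X) (r : R).
Hypothesis mu_ball : forall x r, 0 < r -> (0 < mu (ball x r) < +oo)%E.

(** Each truncation agrees almost everywhere with its mean on each ball about [z] of positive
    integer radius. These are countably many conditions, so almost every point satisfies all of them
    and can be compared with one fixed such point [x0]. *)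
Lemma ae_constant (f : X -> R) : measurable_fun [set: X] f ->
  (forall (N : nat) z s, 0 < s ->
    \int[mu]_(x in ball z s) `|clip N%:R (f x) - mean mu (clip N%:R \o f) z s| = 0) ->
  exists k : R, f = cst k %[ae mu].
Proof.
move=> mf osc0.
have [[z _]|nX] := pselect (exists x : X, True); last first.
  by exists 0; apply: aeW => x; case: nX; exists x.
pose m (N n : nat) := mean mu (clip N%:R \o f) z n.+1%:R.
have ae1 N n : \forall x \ae mu, ball z n.+1%:R x -> clip N%:R (f x) = m N n.
  have n0 : 0 < n.+1%:R :> R by [].
  have mB := @measurable_mball _ _ X z n.+1%:R.
  have /andP[_ Boo] := mu_ball z n0.
  have mh : measurable_fun (ball z n.+1%:R) (fun x => clip N%:R (f x) - m N n).
    apply: measurable_funB => //; apply: (measurableT_comp (measurable_clip _)).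
    exact: measurable_funS mf.
  have ih : mu.-integrable (ball z n.+1%:R) (EFin \o (fun x => clip N%:R (f x) - m N n)).
    apply: (@integrable_le_bound _ _ _ _ _ _ (N%:R + `|m N n|)) => // x _.
    by rewrite (le_trans (ler_normB _ _))// lerD2r norm_clip_le.
  have := osc0 N z n.+1%:R n0; rewrite -/(m N n) => h.
  have : (\int[mu]_(x in ball z n.+1%:R) `|(clip N%:R (f x) - m N n)%:E| = 0)%E.
    by rewrite -[LHS]fineK ?[fine _]h//; exact: (integrable_fin_num mB (integrable_norm ih)).
  move=> /(ae_eq_integral_abs _ mB) -/(_ _); rewrite measurable_EFinP => /(_ mh) h'.
  apply: filterS h' => x + Bx => /(_ Bx) [] /eqP.
  by rewrite subr_eq0 => /eqP.
have /ae_foralln ae2 N : \forall x \ae mu, forall n, ball z n.+1%:R x -> clip N%:R (f x) = m N n.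
  exact/ae_foralln.
have [x0 hx0] : exists x0, forall N n, ball z n.+1%:R x0 -> clip N%:R (f x0) = m N n.
  (* If every point were exceptional, the unit ball would lie in a null set. *)
  apply: contrapT => nx0; have [A [mA A0 sA]] := ae2.
  have /andP[+ _] := mu_ball z ltr01; rewrite ltNge => /negP; apply.
  rewrite -A0; apply: le_measure; rewrite ?inE//; first exact: measurable_mball.
  by move=> x _; apply: sA => hx; apply: nx0; exists x.
exists (f x0); apply: filterS ae2 => x hx _ /=.
(* A ball containing both points and a level at which neither value is truncated. *)
pose n := Num.truncn (Num.max (mdist z x) (mdist z x0)).
pose N := (Num.truncn (Num.max `|f x| `|f x0|)).+1.
have nP : Num.max (mdist z x) (mdist z x0) < n.+1%:R by exact: truncnS_gt.
have NP : Num.max `|f x| `|f x0| < N%:R by exact: truncnS_gt.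
move: nP NP; rewrite !gt_max => /andP[nx nx0] /andP[Nx Nx0].
rewrite -(clip_id (ltW Nx)) -(clip_id (ltW Nx0)).
by rewrite (hx N n) ?(hx0 N n)//; exact/mem_mball.
Qed.

End ae_constant.

Section doubling_measure.
Set Implicit Arguments.
Unset Strict Implicit.
Context {R : realType} {disp : measure_display} {X : borelMetricType R disp}.
Variable mu : {measure set X -> \bar R}.
Hypothesis mu_doubling : doubling mu.

(* An alias of [mu], to attach the sigma-finiteness that Tonelli's theorem requires. *)
Definition doubling_measure (_ : doubling mu) : set X -> \bar R := mu.

HB.instance Definition _ := Measure.on (doubling_measure mu_doubling).
HB.instance Definition _ := Measure_isSigmaFinite.Build _ _ _
  (doubling_measure mu_doubling) (sigma_finite_mball mu_doubling.1).

End doubling_measure.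

(** Once [mu] is destructed, the repackaged measure is convertible to it; this transports the result
    back to [mu]. *)
Lemma doubling_measureE (R : realType) (disp : measure_display)
    (X : borelMetricType R disp) (mu : {measure set X -> \bar R})
    (h : doubling mu) : [the {measure set X -> \bar R} of doubling_measure h] = mu.
Proof. by case: mu h => m [c1 c2] h. Qed.

(** * The two Besov spaces *)

Section besov.
Set Implicit Arguments.
Unset Strict Implicit.
Context {R : realType} {disp : measure_display} {X : borelMetricType R disp}.
Variable mu : {sigma_finite_measure set X -> \bar R}.
Implicit Types (x y z : X) (r p q : R) (f : X -> R).
Hypothesis mu_doubling : doubling mu.
Local Notation V := (vol mu).

Let mu_ball : forall x r, 0 < r -> (0 < mu (ball x r) < +oo)%E.
Proof. by case: mu_doubling. Qed.

Lemma doubling_vol :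
  exists c, forall x r, 0 < r -> V x (2 * r) <= c * V x r.
Proof.
have [_ [c dbl]] := mu_doubling; exists c => x r r0.
by rewrite -lee_fin EFinM -!volE// ?mulr_gt0// dbl.
Qed.

Lemma constants_Lp_loc p f : 0 < p -> constants mu f -> Lp_loc mu p f.
Proof.
move=> p0 [mf [k fk]]; split => // x r r0.
have mB := @measurable_mball _ _ X x r.
have mfB : measurable_fun [set: X] (f \_ (ball x r)).
  by apply/(measurable_restrictT _ _).1 => //; exact: measurable_funS mf.
apply/andP; split; first by rewrite inE.
rewrite inE /= /finite_norm unlock /=; apply: poweR_lty.
have mpow (h : X -> R) : measurable_fun [set: X] h ->
    measurable_fun [set: X] (fun y => (`|h y| `^ p)%:E).
  move=> mh; apply/measurable_EFinP; apply: (measurableT_comp (measurable_powR p)).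
  exact: measurableT_comp.
have mcB : measurable_fun [set: X] ((cst k : X -> R) \_ (ball x r)).
  by apply/(measurable_restrictT _ _).1.
apply: (@le_lt_trans _ _ (\int[mu]_y (`|(f \_ (ball x r)) y| `^ p)%:E)%E).
  by apply: le_integral_nonneg => y _; rewrite -?poweR_EFin ?poweR_ge0.
rewrite (ge0_ae_eq_integral _ (mpow _ mfB) (mpow _ mcB))//.
- apply: (@le_lt_trans _ _ (\int[mu]_(y in ball x r) (`|k| `^ p)%:E)%E); last first.
    by rewrite integral_cst// lte_mul_pinfty ?lee_fin ?powR_ge0//; case/andP: (mu_ball x r0).
  rewrite [leRHS]integral_mkcond; apply: le_integral_nonneg => [y _|y _].
    by rewrite lee_fin powR_ge0.
  rewrite !patchE; case: ifPn => _ //.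
  by rewrite normr0 powR0// gt_eqF.
- apply: filterS fk => y /(_ Logic.I) /= fky _.
  by rewrite !patchE; case: ifP => // _; rewrite fky.
Qed.

(** The easy inclusion for both spaces: a pair with [f x <> f y] has a coordinate in the null set
    where [f] differs from [k], and such pairs form a null set of the product. *)
Lemma constants_integral0 f (Psi : X * X -> \bar R) : constants mu f ->
  (forall u, (0 <= Psi u)%E) -> (forall x y, f x = f y -> Psi (x, y) = 0) ->
  (\int[mu \x mu]_u Psi u = 0)%E.
Proof.
move=> [mf [k fk]] Psi0 Psieq.
pose S := [set x | f x != k].
have mS : measurable S.
  rewrite (_ : S = [set: X] `&` f @^-1` ~` [set k]).
    by apply: mf => //; apply: measurableC.
  by rewrite setTI; apply/seteqP; split => x /= /eqP.
have S0 : mu S = 0.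
  apply/(negligibleP _ mS).1; apply: negligibleS fk => x /= /eqP fxk.
  by move=> /(_ Logic.I).
apply: (@integral_null_support _ _ _ (mu \x mu)%E (S `*` setT `|` setT `*` S)).
- by apply: measurableU; exact: measurableX.
- apply: null_set_setU; try exact: measurableX.
    by rewrite /= product_measure1E// [X in (X * _)%E]S0 mul0e.
  by rewrite /= product_measure1E// [X in (_ * X)%E]S0 mule0.
- exact: Psi0.
move=> [x y] nS; apply: Psieq; apply: contrapT => fxy; apply: nS => /=.
have [fx|fx] := eqVneq (f x) k; last by left.
by right; split => //; apply/eqP => fy; apply: fxy; rewrite fx fy.
Qed.

Section converse.
Variable d : R.
Hypotheses (d1 : 1 <= d) (mu_poincare : poincare mu d).

(** Common core of both parts. The majorant may depend on the truncation level and the ball, a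
    freedom that the second space requires; it is taken on the ball enlarged by the Poincare
    dilation [lambda]. *)
Lemma constants_of_local_bound f : measurable_fun [set: X] f ->
  (forall (N : nat) z s, 0 < s -> exists Phi : X * X -> \bar R, exists2 R0 : R, 0 < R0 &
    [/\ forall u, (0 <= Phi u)%E, (\int[mu \x mu]_u Phi u < +oo)%E &
    forall x y, ball z s x -> 0 < mdist x y < R0 ->
    ((`|clip N%:R (f x) - clip N%:R (f y)| `^ d
      / (mdist x y `^ d * V x (mdist x y)))%:E <= Phi (x, y))%E]) ->
  constants mu f.
Proof.
move=> mf bound; split => //; apply: (ae_constant mu_ball mf) => N z s s0.
have [lambda [cP [l1 cP0 P]]] := mu_poincare.
have [c dbl] := doubling_vol.
have ls0 : 0 < lambda * s by rewrite mulr_gt0//; lra.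
have [Phi [R0 R00 [Phi0 Phioo PhiK]]] := bound N z (lambda * s) ls0.
have mc : measurable_fun [set: X] (clip N%:R \o f).
  exact: (measurableT_comp (measurable_clip _)).
have cN x : `|(clip N%:R \o f) x| <= N%:R by exact: norm_clip_le.
exact: (mean_oscillation0 mu_ball dbl mc cN d1 s0 l1 cP0
  (fun g => P z s g s0) Phi0 Phioo R00 PhiK).
Qed.

Lemma besov_constants : besov mu 1 d = constants mu.
Proof.
have d1' := d1.
pose Psi f (u : X * X) := (if u.1 == u.2 then 0
  else (`|f u.1 - f u.2| / mdist u.1 u.2 `^ 1) `^ d / V u.1 (mdist u.1 u.2))%:E.
have Psi0 f u : (0 <= Psi f u)%E.
  by rewrite /Psi; case: ifPn => // _; rewrite lee_fin divr_ge0 ?powR_ge0// fine_ge0.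
apply/seteqP; split => [f [[mf _] foo]|f cf]; last first.
  split; first by apply: constants_Lp_loc => //; lra.
  rewrite (constants_integral0 cf (Psi0 f))// /Psi => x y /= ->.
  by case: ifPn => // _; rewrite subrr normr0 mul0r powR0 ?mul0r// gt_eqF//; lra.
apply: constants_of_local_bound => // N z s s0.
(* The Besov integrand itself is the majorant, as truncation only shrinks differences; the radius 1
   is arbitrary. *)
exists (Psi f), 1 => //; split; [exact: (Psi0 f)|exact: foo|].
move=> x y _ /andP[xy _]; rewrite /Psi /= ifN; last by rewrite -mdist_gt0.
have V0 := vol_gt0 mu_ball x xy.
rewrite lee_fin powRr1 ?(ltW xy)// powRM// ?invr_ge0 ?(ltW xy)//.
rewrite -[(mdist x y)^-1]powR_inv1 ?(ltW xy)// -powRrM mulN1r powRN.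
rewrite -mulrA -invfM ler_wpM2r ?invr_ge0 ?mulr_ge0 ?powR_ge0 ?(ltW V0)//.
by apply: ge0_ler_powR; rewrite ?nnegrE ?clip_dist//; lra.
Qed.

Lemma besov_crit_constants p : lower_dimension mu d -> 0 < p -> p <= d ->
  besov_crit mu p = constants mu.
Proof.
move=> [C ldim] p0 pd; have d1' := d1.
pose Psi f (u : X * X) := (if u.1 == u.2 then 0
  else `|f u.1 - f u.2| `^ p / V u.1 (mdist u.1 u.2) ^+ 2)%:E.
have Psi0 f u : (0 <= Psi f u)%E.
  by rewrite /Psi; case: ifPn => // _; rewrite lee_fin divr_ge0 ?powR_ge0// exprn_ge0// fine_ge0.
apply/seteqP; split => [f [[mf _] foo]|f cf]; last first.
  split; first exact: constants_Lp_loc.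
  rewrite (constants_integral0 cf (Psi0 f))// /Psi => x y /= ->.
  by case: ifPn => // _; rewrite subrr normr0 powR0 ?mul0r// gt_eqF.
apply: constants_of_local_bound => // N z s s0.
(* In a space without two distinct points there is nothing to bound. Otherwise the distance of any
   such pair is an admissible radius [R0], positive and below twice the diameter. *)
have [[[a b] /= ab]|nab] := pselect (exists u : X * X, u.1 != u.2); last first.
  exists (cst 0%E), 1 => //; split => //; first by rewrite integral0.
  by move=> x y _ /andP[xy _]; case: nab; exists (x, y); rewrite -mdist_gt0.
set R0 := mdist a b; have R00 : 0 < R0 by rewrite mdist_gt0.
have R0diam : (R0%:E < 2%:E * @diameter R disp X)%E.
  apply: (@lt_le_trans _ _ (2%:E * R0%:E)%E).
    by rewrite -EFinM lte_fin; lra.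
  by rewrite lee_wpmul2l//; apply: ereal_sup_ubound; exists (a, b).
(* [M] bounds [V x R0] for all [x] in [ball z s]. In [K], the power of [2 * N%:R] comes from trading
   exponents, the rest from the lower dimension bound, and the added 1 ensures positivity. *)
pose M := V z (s + R0); have M0 : 0 < M by apply: (vol_gt0 mu_ball); lra.
pose K := ((2 * N%:R) `^ (d - p) * (`|C| * M / R0 `^ d)) + 1.
have h0 : 0 <= (2 * N%:R) `^ (d - p) * (`|C| * M / R0 `^ d).
  by rewrite mulr_ge0 ?powR_ge0// mulr_ge0 ?invr_ge0 ?powR_ge0// mulr_ge0// ltW.
have K0 : 0 < K by rewrite /K; lra.
exists (fun u => K%:E * Psi f u)%E, R0 => //; split.
- by move=> u; apply: mule_ge0 (Psi0 f u); rewrite lee_fin; exact: ltW K0.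
- exact: integralZl_lty K0 (Psi0 f) foo.
move=> x y /mem_mball zx /andP[xy xyR]; rewrite /Psi /= ifN; last by rewrite -mdist_gt0.
have V0 := vol_gt0 mu_ball x xy.
have /= := ldim x (mdist x y) R0 xy (ltW xyR) R0diam.
rewrite powRM ?invr_ge0 ?(ltW R00) ?(ltW xy)//.
rewrite -[(mdist x y)^-1]powR_inv1 ?(ltW xy)// -powRrM mulN1r powRN.
have xyd : 0 < mdist x y `^ d by rewrite powR_gt0.
have R0d : 0 < R0 `^ d by rewrite powR_gt0.
have VM : V x R0 <= M by apply: (le_vol mu_ball) => //; lra.
move=> hld.
have {hld} h1 : (mdist x y `^ d)^-1 <= `|C| * M / R0 `^ d / V x (mdist x y).
  rewrite mulrAC ler_pdivlMr// mulrC; apply: le_trans hld _.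
  rewrite -mulrA; apply: (@le_trans _ _ (`|C| * (V x R0 / V x (mdist x y)))).
    by rewrite ler_wpM2r ?ler_norm// divr_ge0// ltW// (vol_gt0 mu_ball).
  by rewrite ler_wpM2l// ler_pM2r ?invr_gt0.
rewrite -EFinM lee_fin.
set D := `|clip _ _ - _|; set F := `|f x - f y|.
have DF : D <= F by exact: clip_dist.
have D0 : 0 <= D by exact: normr_ge0.
have D2N : D <= 2 * N%:R.
  rewrite (le_trans (ler_normB _ _))//.
  have := @norm_clip_le _ N%:R (f x) (ler0n _ _).
  by have := @norm_clip_le _ N%:R (f y) (ler0n _ _); lra.
(* Truncated differences are at most [2 * N%:R], so the excess power [d - p] is bounded by a
   constant. *)
have h2 : D `^ d <= (2 * N%:R) `^ (d - p) * F `^ p.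
  have -> : D `^ d = D `^ (d - p) * D `^ p.
    by rewrite -powRD subrK// gt_eqF//; lra.
  apply: ler_pM; rewrite ?powR_ge0//; apply: ge0_ler_powR; rewrite ?nnegrE//; lra.
rewrite invfM mulrA.
apply: (@le_trans _ _ ((2 * N%:R) `^ (d - p) * F `^ p *
  (`|C| * M / R0 `^ d / V x (mdist x y)) / V x (mdist x y))).
  by rewrite ler_pM2r ?invr_gt0//; apply: ler_pM; rewrite ?powR_ge0 ?invr_ge0 ?powR_ge0.
have -> : (2 * N%:R) `^ (d - p) * F `^ p *
    (`|C| * M / R0 `^ d / V x (mdist x y)) / V x (mdist x y) =
  (K - 1) * (F `^ p / V x (mdist x y) ^+ 2).
  by rewrite /K addrK expr2 invfM; ring.
rewrite ler_wpM2r//; last by lra.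
by rewrite divr_ge0 ?powR_ge0// exprn_ge0// ltW.
Qed.

End converse.
End besov.

Theorem theorem1p5 (R : realType) (disp : measure_display)
    (X : borelMetricType R disp) (mu : {measure set X -> \bar R}) (d : R)
    (mu_doubling : doubling mu) (d_ge1 : 1 <= d) (mu_poincare : poincare mu d) :
  besov mu 1 d = constants mu /\
  (lower_dimension mu d ->
   forall p : R, 0 < p -> p <= d -> besov_crit mu p = constants mu).
Proof.
have nuE := doubling_measureE mu_doubling.
(* The argument runs for [nu], which is [mu] equipped with sigma-finiteness. *)
set nu := [the {measure set X -> \bar R} of doubling_measure mu_doubling] in nuE.
have nu_doubling : doubling nu by rewrite nuE.
have nu_poincare : poincare nu d by rewrite nuE.
rewrite -nuE; split=> [|ldim p p0 pd].
  exact: (besov_constants nu_doubling d_ge1 nu_poincare).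
exact: (besov_crit_constants nu_doubling d_ge1 nu_poincare ldim p0 pd).
Qed.
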